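(* Let $\alpha>0$ and let $T : C_c(\mathbb{R}_+)\to C_0(\mathbb{R}_+)$ be an integral transform given by the formula $$T(f)(y) := \int_{\mathbb{R}_+} K(yx) f(x)\, x\,dx,$$ where $K\in C^2(\mathbb{R}_+)$ is a bounded function. Suppose that (i) $T$ satisfies Bessel's differential property of order $\alpha$: for every $f\in C_c^2(\mathbb{R}_+)$ and every $y\in\mathbb{R}_+$, $$T\left(f''+\frac{1}{x}f'-\frac{\alpha^2}{x^2}f\right)(y) = -y^2\,T(f)(y);$$ (ii) there exist a function $f_*\in C_c^2(\mathbb{R}_+)$ and a point $y_*\in\mathbb{R}_+$ such that $$T(f_* )(y_* ) = \mathcal{H}_\alpha(f_* )(y_* )\neq 0.$$ Then $T$ is the Hankel transform $\mathcal{H}_\alpha$, i.e. $T(f)=\mathcal{H}_\alpha(f)$ for every $f\in C_c(\mathbb{R}_+)$.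
   Context: $\mathbb{R}_+=(0,\infty)$. $C_c(\mathbb{R}_+)$ (resp. $C_c^2(\mathbb{R}_+)$) is the space of continuous (resp. $C^2$) compactly supported complex-valued functions on $\mathbb{R}_+$, and $C_0(\mathbb{R}_+)$ is the space of continuous functions on $\mathbb{R}_+$ vanishing at infinity. In (i), $\frac1x f'$ and $\frac{\alpha^2}{x^2}f$ denote the functions $x\mapsto \frac{1}{x}f'(x)$ and $x\mapsto\frac{\alpha^2}{x^2}f(x)$. The Hankel transform of order $\alpha$ is the map $\mathcal{H}_\alpha : C_c(\mathbb{R}_+)\to C_0(\mathbb{R}_+)$, $$\mathcal{H}_\alpha(f)(y) := \int_{\mathbb{R}_+} J_\alpha(yx) f(x)\,x\,dx,$$ where $J_\alpha$ is the Bessel function of the first kind of order $\alpha$, a bounded solution on $\mathbb{R}_+$ of Bessel's equation $r^2f''(r)+rf'(r)+(r^2-\alpha^2)f(r)=0$, given by $$J_\alpha(r)=\frac1\pi\int_0^\pi\cos(\alpha t-r\sin t)\,dt-\frac{\sin(\alpha\pi)}{\pi}\int_0^\infty e^{-r\sinh(t)-\alpha t}\,dt,\qquad r\in\mathbb{R}_+.$$ *)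

(* Defs.v *)
From Stdlib Require Export Reals.
From Coquelicot Require Export Coquelicot.
Open Scope R_scope.

(* Functions on R_+ = (0, oo) are represented by total functions R -> C; only
   their values at positive arguments are ever constrained or used. *)

Definition continuous_Rplus (f : R -> C) : Prop :=
  forall x : R, 0 < x -> continuous f x.

(* Derivative of a complex-valued function of a real variable, taken
   componentwise; meaningful at the points where [f] is differentiable. *)
Definition derive_RC (f : R -> C) (x : R) : C :=
  (Derive (fun t => Re (f t)) x, Derive (fun t => Im (f t)) x).

Definition derivable_Rplus (f : R -> C) : Prop :=
  forall x : R, 0 < x -> @ex_derive R_AbsRing C_R_NormedModule f x.

Definition C2_Rplus (f : R -> C) : Prop :=
  derivable_Rplus f /\ derivable_Rplus (derive_RC f) /\
  continuous_Rplus (derive_RC (derive_RC f)).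

Definition bounded_Rplus (f : R -> C) : Prop :=
  exists M : R, forall x : R, 0 < x -> Cmod (f x) <= M.

(* The support is taken in R_+, so it must stay away from 0 as well as from
   infinity: the compact subsets of R_+ are the closed sets contained in some
   [a, b] with 0 < a. *)
Definition compact_support_Rplus (f : R -> C) : Prop :=
  exists a b : R, 0 < a /\ forall x : R, 0 < x -> x < a \/ b < x -> f x = 0%C.

(* Likewise "at infinity" refers to the locally compact space R_+, that is,
   both as y tends to 0 and as y tends to infinity. *)
Definition vanishes_at_infinity_Rplus (f : R -> C) : Prop :=
  forall eps : R, 0 < eps ->
  exists a b : R, 0 < a /\
    forall x : R, 0 < x -> x < a \/ b < x -> Cmod (f x) < eps.

Definition Cc (f : R -> C) : Prop :=
  continuous_Rplus f /\ compact_support_Rplus f.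

Definition Cc2 (f : R -> C) : Prop :=
  C2_Rplus f /\ compact_support_Rplus f.

Definition C0 (f : R -> C) : Prop :=
  continuous_Rplus f /\ vanishes_at_infinity_Rplus f.

Definition integral_Rplus (g : R -> C) : C :=
  @RInt_gen C_R_CompleteNormedModule g (at_right 0) (Rbar_locally p_infty).

Definition integral_transform (K f : R -> C) (y : R) : C :=
  integral_Rplus (fun x => (K (y * x)%R * f x * RtoC x)%C).

Definition BesselJ (alpha r : R) : R :=
  1 / PI * RInt (fun t => cos (alpha * t - r * sin t)) 0 PI
  - sin (alpha * PI) / PI *
    RInt_gen (fun t => exp (- r * sinh t - alpha * t))
             (at_point 0) (Rbar_locally p_infty).

Definition Hankel (alpha : R) : (R -> C) -> R -> C :=
  integral_transform (fun r => RtoC (BesselJ alpha r)).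

Definition Bessel_op (alpha : R) (f : R -> C) (x : R) : C :=
  (derive_RC (derive_RC f) x + RtoC (1 / x) * derive_RC f x
   - RtoC (alpha ^ 2 / x ^ 2) * f x)%C.

(* Main.v *)
(* Testing (i) at y = 1 against bumps and integrating by parts shows that K solves
   Bessel's equation; J_alpha solves it by differentiating its two integrals: each
   Bessel expression is the integral of an exact derivative, and the boundary terms
   (r - alpha) sin(alpha pi) / pi cancel.

   Bounded solutions form a line: for such a solution u, the function r u u' is
   nondecreasing on (0, alpha], and it cannot be negative there since u^2 would then
   grow logarithmically at 0. So u^2 is nondecreasing on (0, alpha], and u(alpha) = 0
   forces u = 0. Applied to J_alpha and to K - (K(alpha) / J_alpha(alpha)) J_alpha, this
   gives K = c J_alpha for some complex c, and (ii) gives c = 1. *)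

Require Import Defs.
From Stdlib Require Import Lra Lia Classical FunctionalExtensionality.
From Corelib Require Import ssreflect.

(** The difficulty is to single out [J_alpha] among all solutions without knowing its behaviour at 0
    or exhibiting a second, unbounded solution. The point [alpha] is where the coefficient in
    [(r u')' = (alpha^2 / r - r) u] changes sign, hence the right end of the interval on which the
    monotonicity argument works; evaluation at [alpha] is therefore injective on bounded solutions.
    That [J_alpha] does not vanish at [alpha] is not computed: otherwise it would vanish
    identically, against the nonzero value in (ii).

    The kernel depends on [y x] only, so [y = 1] already shows all of [K]; and real-valued bumps
    separate its real and imaginary parts, so that the analysis of the equation is purely real. Each
    of the two terms of [J_alpha] leaves a residue in the equation unless [sin (alpha pi) = 0],
    which is why both have to be differentiated twice. *)

(** * Bounded solutions of Bessel's equation on R_+ *)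

(* Bessel's equation as a first-order system: [v] stands for [x u'], so that the
   second equation reads [(x u')' = (alpha^2 / x - x) u]. *)
Definition bessel_sol (alpha : R) (u v : R -> R) : Prop :=
  forall x : R, 0 < x ->
    is_derive u x (v x / x) /\ is_derive v x ((alpha ^ 2 / x - x) * u x).

Lemma bessel_sol_lin (alpha : R) (u1 v1 u2 v2 : R -> R) (c1 c2 : R) :
  bessel_sol alpha u1 v1 -> bessel_sol alpha u2 v2 ->
  bessel_sol alpha (fun x => c1 * u1 x + c2 * u2 x)
                   (fun x => c1 * v1 x + c2 * v2 x).
Proof.
intros H1 H2 x Hx.
destruct (H1 x Hx) as [Du1 Dv1]; destruct (H2 x Hx) as [Du2 Dv2].
split.
- replace ((c1 * v1 x + c2 * v2 x) / x)
    with (plus (scal c1 (v1 x / x)) (scal c2 (v2 x / x)))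
    by (unfold plus, scal; simpl; unfold mult; simpl; field; lra).
  apply: (is_derive_plus (fun x => c1 * u1 x) (fun x => c2 * u2 x));
    now apply: is_derive_scal.
- replace ((alpha ^ 2 / x - x) * (c1 * u1 x + c2 * u2 x))
    with (plus (scal c1 ((alpha ^ 2 / x - x) * u1 x))
               (scal c2 ((alpha ^ 2 / x - x) * u2 x)))
    by (unfold plus, scal; simpl; unfold mult; simpl; ring).
  apply: (is_derive_plus (fun x => c1 * v1 x) (fun x => c2 * v2 x));
    now apply: is_derive_scal.
Qed.

Lemma nonneg_derive_incr (f df : R -> R) (a b : R) :
  a <= b ->
  (forall x, a <= x <= b -> is_derive f x (df x)) ->
  (forall x, a <= x <= b -> 0 <= df x) ->
  f a <= f b.
Proof.
intros Hab Hd Hpos.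
destruct (MVT_gen f a b df) as [c [Hc E]];
  rewrite ?Rmin_left ?Rmax_right //.
- intros x Hx; apply Hd; lra.
- intros x Hx; apply continuity_pt_filterlim.
  apply: (ex_derive_continuous f); eexists; now apply Hd.
- rewrite -> Rmin_left, Rmax_right in Hc by lra.
  assert (0 <= df c * (b - a)) by (apply Rmult_le_pos; [now apply Hpos | lra]).
  lra.
Qed.

Lemma bessel_sol_uv_incr (alpha : R) (u v : R -> R) (x y : R) :
  0 < alpha -> bessel_sol alpha u v -> 0 < x -> x <= y -> y <= alpha ->
  u x * v x <= u y * v y.
Proof.
intros Ha Hs Hx Hxy Hy.
apply (nonneg_derive_incr (fun t => u t * v t)
  (fun t => v t ^ 2 / t + (alpha ^ 2 / t - t) * u t ^ 2) x y Hxy).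
- intros t Ht; destruct (Hs t) as [Du Dv]; [lra|].
  replace (v t ^ 2 / t + (alpha ^ 2 / t - t) * u t ^ 2)
    with (plus (mult (v t / t) (v t)) (mult (u t) ((alpha ^ 2 / t - t) * u t)))
    by (unfold plus, mult; simpl; field; lra).
  apply: (is_derive_mult u v); auto.
  intros; unfold mult; simpl; ring.
- intros t Ht.
  (* This is where [t <= alpha] enters: the factor [alpha - t] is nonnegative. *)
  replace (alpha ^ 2 / t - t) with ((alpha - t) * (alpha + t) / t)
    by (field; lra).
  apply Rplus_le_le_0_compat.
  + apply Rmult_le_pos; [apply pow2_ge_0|].
    apply Rlt_le, Rinv_0_lt_compat; lra.
  + apply Rmult_le_pos; [|apply pow2_ge_0].
    apply Rmult_le_pos; [apply Rmult_le_pos; lra|].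
    apply Rlt_le, Rinv_0_lt_compat; lra.
Qed.

(* Otherwise [x (u^2)' = 2 u v] is at most some [-2 d < 0] near 0, and [u^2]
   grows at least like [2 d ln (1/x)]. *)
Lemma bounded_bessel_sol_uv_ge0 (alpha : R) (u v : R -> R) (M x : R) :
  0 < alpha -> bessel_sol alpha u v ->
  (forall t, 0 < t -> Rabs (u t) <= M) ->
  0 < x -> x <= alpha -> 0 <= u x * v x.
Proof.
intros Ha Hs HM Hx Hxa.
destruct (Rle_or_lt 0 (u x * v x)) as [|Hneg]; [assumption|exfalso].
set (d := - (u x * v x)) in *.
assert (Hd : 0 < d) by (unfold d; lra).
(* [y] is so close to 0 that [2 * d * ln (x / y) = M ^ 2 + 1], which pushes [u y ^ 2] above its
   bound [M ^ 2]. *)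
set (y := x * exp (- ((M ^ 2 + 1) / (2 * d)))).
assert (Hq : 0 < (M ^ 2 + 1) / (2 * d)).
{ apply Rdiv_lt_0_compat; [|lra]. pose proof (pow2_ge_0 M); lra. }
assert (Hy0 : 0 < y) by (apply Rmult_lt_0_compat; [lra|apply exp_pos]).
assert (Hyx : y <= x).
{ assert (exp (- ((M ^ 2 + 1) / (2 * d))) <= exp 0)
    by (apply Rlt_le, exp_increasing; lra).
  rewrite exp_0 in H. unfold y.
  pose proof (Rmult_le_compat_l x _ _ (Rlt_le _ _ Hx) H). lra. }
assert (Hln : ln y = ln x - (M ^ 2 + 1) / (2 * d)).
{ unfold y. rewrite -> ln_mult; [|lra|apply exp_pos]. rewrite ln_exp. ring. }
assert (I : - (u y ^ 2 + 2 * d * ln y) <= - (u x ^ 2 + 2 * d * ln x)).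
{ apply (nonneg_derive_incr (fun t => - (u t ^ 2 + 2 * d * ln t))
    (fun t => - (2 * (u t * v t) / t + 2 * d / t)) y x Hyx).
  - intros t Ht; destruct (Hs t) as [Du _]; [lra|].
    auto_derive; [repeat split; [eexists; exact Du|lra]|].
    rewrite (is_derive_unique (fun x => u x) t _ Du). field; lra.
  - intros t Ht.
    pose proof (bessel_sol_uv_incr alpha u v t x Ha Hs ltac:(lra) ltac:(lra) Hxa).
    replace (- (2 * (u t * v t) / t + 2 * d / t))
      with (2 * (- (u t * v t) - d) / t) by (field; lra).
    apply Rmult_le_pos; [unfold d; lra|].
    apply Rlt_le, Rinv_0_lt_compat; lra. }
rewrite Hln in I.
replace (2 * d * (ln x - (M ^ 2 + 1) / (2 * d)))
  with (2 * d * ln x - (M ^ 2 + 1)) in I by (field; lra).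
pose proof (pow2_ge_0 (u x)).
assert (u y ^ 2 <= M ^ 2) by (apply pow_maj_Rabs; auto).
lra.
Qed.

Lemma bounded_bessel_sol_vanish_near_0 (alpha : R) (u v : R -> R) (M : R) :
  0 < alpha -> bessel_sol alpha u v ->
  (forall t, 0 < t -> Rabs (u t) <= M) ->
  u alpha = 0 -> forall x, 0 < x -> x <= alpha -> u x = 0.
Proof.
intros Ha Hs HM H0 x Hx Hxa.
assert (I : u x ^ 2 <= u alpha ^ 2).
{ apply (nonneg_derive_incr (fun t => u t ^ 2) (fun t => 2 * (u t * v t) / t));
    [exact Hxa| |].
  - intros t Ht; destruct (Hs t) as [Du _]; [lra|].
    auto_derive; [eexists; exact Du|].
    rewrite (is_derive_unique (fun x => u x) t _ Du). field; lra.
  - intros t Ht.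
    pose proof (bounded_bessel_sol_uv_ge0 alpha u v M t Ha Hs HM ltac:(lra) ltac:(lra)).
    apply Rmult_le_pos; [lra|]. apply Rlt_le, Rinv_0_lt_compat; lra. }
rewrite H0 in I. apply Rsqr_0_uniq. unfold Rsqr.
pose proof (pow2_ge_0 (u x)); simpl in *; lra.
Qed.

(* The energy [u^2 + v^2] satisfies [|E'| <= c E] on [a, b]. *)
Lemma bessel_sol_unique (alpha : R) (u v : R -> R) (a b : R) :
  0 < a -> a <= b -> bessel_sol alpha u v -> u a = 0 -> v a = 0 -> u b = 0.
Proof.
intros Ha Hab Hs Hu Hv.
(* The derivative of the energy is [2 u v (1 / t + alpha^2 / t - t)]; [c] bounds the last factor on
   [[a, b]], and [2 |u v| <= u^2 + v^2]. So the energy times [exp (- (c * t))] cannot increase. *)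
set (c := 1 / a + alpha ^ 2 / a + b).
set (E := fun t => (u t ^ 2 + v t ^ 2) * exp (- (c * t))).
assert (I : - E a <= - E b).
{ apply (nonneg_derive_incr (fun t => - E t)
    (fun t => (c * (u t ^ 2 + v t ^ 2)
               - 2 * (u t * v t) * (1 / t + alpha ^ 2 / t - t)) * exp (- (c * t)))
    a b Hab).
  - intros t Ht; destruct (Hs t) as [Du Dv]; [lra|].
    unfold E; auto_derive;
      [repeat split; [eexists; exact Du|eexists; exact Dv]|].
    rewrite (is_derive_unique (fun x => u x) t _ Du).
    rewrite (is_derive_unique (fun x => v x) t _ Dv). simpl. field; lra.
  - intros t Ht. apply Rmult_le_pos; [|apply Rlt_le, exp_pos].
    assert (Hk : Rabs (1 / t + alpha ^ 2 / t - t) <= c).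
    { assert (/ t <= / a) by (apply Rinv_le_contravar; lra).
      assert (0 < / t) by (apply Rinv_0_lt_compat; lra).
      pose proof (pow2_ge_0 alpha).
      assert (alpha ^ 2 / t <= alpha ^ 2 / a)
        by (apply Rmult_le_compat_l; assumption).
      assert (0 <= alpha ^ 2 / t) by (apply Rmult_le_pos; lra).
      unfold c; apply Rabs_le; lra. }
    assert (H2 : Rabs (2 * (u t * v t)) <= u t ^ 2 + v t ^ 2).
    { pose proof (pow2_ge_0 (u t - v t)). pose proof (pow2_ge_0 (u t + v t)).
      apply Rabs_le; simpl in *; lra. }
    pose proof (Rmult_le_compat _ _ _ _ (Rabs_pos _) (Rabs_pos _) H2 Hk) as H3.
    rewrite <- Rabs_mult in H3. apply Rabs_le_between in H3. lra. }
unfold E in I. rewrite Hu Hv in I.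
pose proof (exp_pos (- (c * b))) as He.
pose proof (pow2_ge_0 (u b)) as Q1. pose proof (pow2_ge_0 (v b)) as Q2.
assert (Q : (u b ^ 2 + v b ^ 2) <= 0).
{ apply Rmult_le_reg_r with (1 := He). simpl in *. lra. }
apply Rsqr_0_uniq. unfold Rsqr. simpl in *; lra.
Qed.

(** Past [alpha] the monotonicity is lost, and uniqueness for the initial value problem takes over.
    It starts from [alpha / 2], interior to the interval where [u] is already known to vanish, so
    that [v] vanishes there too. *)
Lemma bounded_bessel_sol_vanish (alpha : R) (u v : R -> R) (M : R) :
  0 < alpha -> bessel_sol alpha u v ->
  (forall t, 0 < t -> Rabs (u t) <= M) ->
  u alpha = 0 -> forall x, 0 < x -> u x = 0.
Proof.
intros Ha Hs HM H0 x Hx.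
pose proof (bounded_bessel_sol_vanish_near_0 alpha u v M Ha Hs HM H0) as Hnear.
destruct (Rle_or_lt x alpha) as [Hxa|Hxa]; [now apply Hnear|].
apply (bessel_sol_unique alpha u v (alpha / 2) x); try lra; try assumption.
- apply Hnear; lra.
- destruct (Hs (alpha / 2)) as [Du _]; [lra|].
  assert (D0 : is_derive u (alpha / 2) 0).
  { apply (is_derive_ext_loc (fun _ => 0)); [|apply: is_derive_const].
    exists (mkposreal (alpha / 2) ltac:(lra)). intros t Ht.
    apply Rabs_lt_between' in Ht; simpl in Ht.
    symmetry; apply Hnear; lra. }
  apply is_derive_unique in Du. apply is_derive_unique in D0.
  rewrite Du in D0. apply Rmult_eq_reg_r with (/ (alpha / 2)).
  + rewrite Rmult_0_l; exact D0.
  + apply Rinv_neq_0_compat; lra.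
Qed.

(** * Differentiation under the integral sign *)

Lemma MVT_abs (F F1 : R -> R) (x h : R) :
  (forall z, Rabs (z - x) <= Rabs h -> is_derive F z (F1 z)) ->
  exists c, Rabs (c - x) <= Rabs h /\ F (x + h) - F x = F1 c * h.
Proof.
intros D.
assert (B : forall z, Rmin x (x + h) <= z <= Rmax x (x + h) ->
                      Rabs (z - x) <= Rabs h).
{ intros z; unfold Rmin, Rmax; destruct (Rle_dec x (x + h)); intros Hz.
  - rewrite -> !Rabs_pos_eq by lra; lra.
  - rewrite -> !Rabs_left1 by lra; lra. }
destruct (MVT_gen F x (x + h) F1) as [c [Hc E]].
- intros z Hz; apply D, B; lra.
- intros z Hz; apply continuity_pt_filterlim.
  apply: (ex_derive_continuous F); eexists; now apply D, B.
- exists c; split; [now apply B|]. rewrite E; ring.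
Qed.

(** Two mean value steps: the increment of [F] is [h * F1 c], and [F1 c - F1 x] is [F2 c' * (c - x)]
    with [|c - x| <= |h|]. Losing the factor 1/2 of Taylor's formula is harmless. *)
Lemma taylor1_bound (F F1 F2 : R -> R) (x h M : R) :
  (forall z, Rabs (z - x) <= Rabs h ->
     is_derive F z (F1 z) /\ is_derive F1 z (F2 z) /\ Rabs (F2 z) <= M) ->
  Rabs (F (x + h) - F x - h * F1 x) <= h ^ 2 * M.
Proof.
intros H.
destruct (MVT_abs F F1 x h) as [c [Hc E]]; [intros z Hz; now apply H|].
destruct (MVT_abs F1 F2 x (c - x)) as [c' [Hc' E']].
{ intros z Hz; apply H; lra. }
replace (x + (c - x)) with c in E' by ring.
replace (F (x + h) - F x - h * F1 x) with (F2 c' * ((c - x) * h))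
  by (rewrite E; replace (F1 c) with (F1 x + F2 c' * (c - x)) by lra; ring).
rewrite !Rabs_mult.
assert (H2 : Rabs (F2 c') <= M) by (apply H; lra).
rewrite <- (pow2_abs h).
replace (Rabs h ^ 2 * M) with (M * (Rabs h * Rabs h)) by ring.
apply Rmult_le_compat; auto using Rabs_pos.
- rewrite <- Rabs_mult; apply Rabs_pos.
- apply Rmult_le_compat; auto using Rabs_pos; lra.
Qed.

Lemma is_derive_quadratic_error (F : R -> R) (x l d C : R) :
  0 < d ->
  (forall h, Rabs h <= d -> Rabs (F (x + h) - F x - h * l) <= h ^ 2 * C) ->
  is_derive F x l.
Proof.
intros Hd H. apply is_derive_Reals. intros eps Heps.
assert (HC : 0 <= Rabs C) by apply Rabs_pos.
(* The [+ 1] keeps the denominator positive when [C = 0]. *)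
assert (Hq : 0 < eps / (Rabs C + 1)) by (apply Rdiv_lt_0_compat; lra).
exists (mkposreal (Rmin d (eps / (Rabs C + 1))) (Rmin_pos _ _ Hd Hq)); simpl.
intros h Hh0 Hh.
assert (H1 : Rabs h < d) by (eapply Rlt_le_trans; [exact Hh|apply Rmin_l]).
assert (H2 : Rabs h < eps / (Rabs C + 1))
  by (eapply Rlt_le_trans; [exact Hh|apply Rmin_r]).
assert (Hp : 0 < Rabs h) by now apply Rabs_pos_lt.
replace ((F (x + h) - F x) / h - l) with ((F (x + h) - F x - h * l) / h)
  by (field; assumption).
rewrite Rabs_div //.
apply Rle_lt_trans with (Rabs h * Rabs C).
- apply Rmult_le_reg_r with (Rabs h); [exact Hp|].
  replace (Rabs (F (x + h) - F x - h * l) / Rabs h * Rabs h)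
    with (Rabs (F (x + h) - F x - h * l)) by (field; lra).
  eapply Rle_trans; [apply H; lra|].
  rewrite <- (pow2_abs h).
  pose proof (Rle_abs C). pose proof (pow2_ge_0 (Rabs h)).
  replace (Rabs h * Rabs C * Rabs h) with (Rabs h ^ 2 * Rabs C) by ring.
  now apply Rmult_le_compat_l.
- apply Rle_lt_trans with (Rabs h * (Rabs C + 1)).
  + apply Rmult_le_compat_l; lra.
  + apply Rmult_lt_reg_r with (/ (Rabs C + 1)).
    * apply Rinv_0_lt_compat; lra.
    * replace (Rabs h * (Rabs C + 1) * / (Rabs C + 1)) with (Rabs h) by (field; lra).
      exact H2.
Qed.

(** A majorant [g] of the second derivative in the parameter makes the first-order Taylor error of
    the integrand at most [h ^ 2 * g t]; integrated, the error is at most [h ^ 2 * lg], which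
    replaces any dominated convergence argument. Leaving the filters arbitrary lets one statement
    serve both the proper integral over [[0, PI]] and the improper one over the half-line. *)
Lemma is_derive_RInt_gen_param (Fa Fb : (R -> Prop) -> Prop)
  {FFa : ProperFilter Fa} {FFb : ProperFilter Fb}
  (f f1 f2 : R -> R -> R) (g : R -> R) (r d lg : R) :
  0 < d ->
  filter_prod Fa Fb (fun ab => fst ab <= snd ab) ->
  filter_prod Fa Fb (fun ab => forall t, fst ab <= t <= snd ab ->
    forall s, Rabs (s - r) <= d ->
      is_derive (fun s => f s t) s (f1 s t) /\
      is_derive (fun s => f1 s t) s (f2 s t) /\
      Rabs (f2 s t) <= g t) ->
  (forall s, Rabs (s - r) <= d -> ex_RInt_gen (f s) Fa Fb) ->
  ex_RInt_gen (f1 r) Fa Fb ->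
  is_RInt_gen g Fa Fb lg ->
  is_derive (fun s => RInt_gen (f s) Fa Fb) r (RInt_gen (f1 r) Fa Fb).
Proof.
intros Hd Hord Hker Ef Ef1 Ig.
apply (is_derive_quadratic_error _ r _ d lg Hd). intros h Hh.
assert (I0 : is_RInt_gen (f r) Fa Fb (RInt_gen (f r) Fa Fb)).
{ apply (RInt_gen_correct (V := R_CompleteNormedModule)), Ef. rewrite Rminus_diag Rabs_R0; lra. }
assert (Ih : is_RInt_gen (f (r + h)) Fa Fb (RInt_gen (f (r + h)) Fa Fb)).
{ apply (RInt_gen_correct (V := R_CompleteNormedModule)), Ef. now replace (r + h - r) with h by ring. }
assert (I1 : is_RInt_gen (f1 r) Fa Fb (RInt_gen (f1 r) Fa Fb)).
{ now apply (RInt_gen_correct (V := R_CompleteNormedModule)). }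
apply (RInt_gen_norm (Fa := Fa) (Fb := Fb)
  (fun t => f (r + h) t - f r t - h * f1 r t) (fun t => h ^ 2 * g t)).
- exact Hord.
- generalize Hker. apply filter_imp. intros ab H t Ht.
  apply (taylor1_bound (fun s => f s t) (fun s => f1 s t) (fun s => f2 s t)).
  intros z Hz; apply H; [exact Ht|lra].
- apply: (is_RInt_gen_minus (fun t => f (r + h) t - f r t) (fun t => h * f1 r t)).
  + now apply: (is_RInt_gen_minus (f (r + h)) (f r)).
  + now apply: is_RInt_gen_scal.
- now apply: is_RInt_gen_scal.
Qed.

(** * Convergence of improper integrals over the half-line *)

Lemma is_RInt_gen_primitive (f F : R -> R) (l : R) :
  (forall x, is_RInt f 0 x (F x)) ->
  filterlim F (Rbar_locally p_infty) (locally l) ->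
  is_RInt_gen f (at_point 0) (Rbar_locally p_infty) l.
Proof.
intros HF Hl P HP.
apply (Filter_prod _ _ _ (fun a => a = 0) (fun b => P (F b))).
- reflexivity.
- now apply Hl.
- intros a b -> Hb. now exists (F b).
Qed.

Lemma incr_bounded_cv (F : R -> R) (M : R) :
  (forall x y, 0 <= x <= y -> F x <= F y) ->
  (forall x, 0 <= x -> F x <= M) ->
  exists l, filterlim F (Rbar_locally p_infty) (locally l).
Proof.
intros Hinc HM.
destruct (completeness (fun y => exists x, 0 <= x /\ y = F x)) as [l [Hub Hlub]].
- exists M. intros y [x [Hx ->]]. now apply HM.
- exists (F 0), 0; split; [lra|reflexivity].
- exists l. intros P [eps HP].
  destruct (classic (exists x, 0 <= x /\ l - eps < F x)) as [[x [Hx Hl]]|Hn].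
  + exists x. intros y Hy. apply HP. apply Rabs_lt_between'.
    assert (F x <= F y) by (apply Hinc; lra).
    assert (F y <= l) by (apply Hub; exists y; split; [lra|reflexivity]).
    destruct eps as [e He]; simpl in *; lra.
  + exfalso. assert (l <= l - eps).
    { apply Hlub. intros y [x [Hx ->]].
      destruct (Rle_or_lt (F x) (l - eps)); [assumption|].
      exfalso; apply Hn; now exists x. }
    destruct eps as [e He]; simpl in *; lra.
Qed.

Lemma is_lim_exp_neg_mult (a : R) : 0 < a ->
  is_lim (fun x => exp (- (a * x))) p_infty 0.
Proof.
intros Ha. apply (is_lim_comp exp (fun x => - (a * x)) p_infty 0 m_infty).
- apply is_lim_exp_m.
- apply (is_lim_ext (fun x => - a * x)); [intros; ring|].
  replace m_infty with (Rbar_mult (- a) p_infty).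
  + apply is_lim_scal_l, is_lim_id.
  + simpl. destruct (Rle_dec 0 (- a)); [exfalso; lra|reflexivity].
- exists 0; intros y _; discriminate.
Qed.

Lemma is_RInt_gen_exp (a : R) : 0 < a ->
  is_RInt_gen (fun t => exp (- (a * t))) (at_point 0) (Rbar_locally p_infty) (/ a).
Proof.
intros Ha.
apply (is_RInt_gen_primitive _ (fun x => / a - exp (- (a * x)) / a)).
- intros x.
  replace (/ a - exp (- (a * x)) / a)
    with (minus (- (exp (- (a * x)) / a)) (- (exp (- (a * 0)) / a))).
  + apply (is_RInt_derive (fun x => - (exp (- (a * x)) / a))).
    * intros t _. auto_derive; [exact I|]. field; lra.
    * intros t _. apply: (ex_derive_continuous (fun t => exp (- (a * t)))).
      auto_derive; exact I.
  + rewrite -> Rmult_0_r, Ropp_0, exp_0. unfold minus, plus, opp; simpl. field; lra.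
- apply (is_lim_ext (fun x => / a - / a * exp (- (a * x))) _ p_infty (/ a)).
  { intros y. field; lra. }
  replace (Finite (/ a)) with (Rbar_minus (/ a) (Rbar_mult (/ a) 0))
    by (simpl; apply f_equal; ring).
  apply (is_lim_minus _ _ _ (/ a) (Rbar_mult (/ a) 0)).
  + apply is_lim_const.
  + now apply is_lim_scal_l, is_lim_exp_neg_mult.
  + reflexivity.
Qed.

(** By positivity the integrals over [[0, x]] increase with [x]; those of [f] stay below those of
    [g], hence below [lg], and so converge. *)
Lemma ex_RInt_gen_dominated (f g : R -> R) (lg : R) :
  (forall t, continuous f t) -> (forall t, continuous g t) ->
  (forall t, 0 <= t -> 0 <= f t <= g t) ->
  is_RInt_gen g (at_point 0) (Rbar_locally p_infty) lg ->
  ex_RInt_gen f (at_point 0) (Rbar_locally p_infty).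
Proof.
intros Cf Cg Hfg Ig.
assert (If : forall a b, ex_RInt f a b) by (intros; apply: ex_RInt_continuous; auto).
assert (Jg : forall a b, ex_RInt g a b) by (intros; apply: ex_RInt_continuous; auto).
assert (incr : forall h : R -> R, (forall a b, ex_RInt h a b) ->
  (forall t, 0 <= t -> 0 <= h t) ->
  forall x y, 0 <= x <= y -> RInt h 0 x <= RInt h 0 y).
{ intros h Ih Hh x y Hxy.
  rewrite <- (RInt_Chasles h 0 x y) by apply Ih. unfold plus; simpl.
  assert (0 <= RInt h x y) by (apply RInt_ge_0; [lra|apply Ih|intros; apply Hh; lra]).
  lra. }
destruct (incr_bounded_cv (fun x => RInt f 0 x) lg) as [l Hl].
- apply incr; [exact If|]. intros t Ht; now apply Hfg.
- intros x Hx.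
  apply Rle_trans with (RInt g 0 x).
  { apply RInt_le; auto. intros t Ht; apply Hfg; lra. }
  destruct (Rle_or_lt (RInt g 0 x) lg) as [|Hlt]; [assumption|exfalso].
  assert (Hl : locally lg (fun y => y < RInt g 0 x)) by now apply: open_lt.
  destruct (Ig _ Hl) as [Q S HQ [M HS] HQS].
  (* An upper limit beyond [M] makes the integral of [g] smaller than [RInt g 0 x]; being also at
     least [x], it contradicts monotonicity. *)
  destruct (HQS 0 (Rmax x (M + 1))) as [y [Hy1 Hy2]].
  + exact HQ.
  + apply HS. pose proof (Rmax_r x (M + 1)); lra.
  + simpl in Hy1. apply (is_RInt_unique (V := R_CompleteNormedModule)) in Hy1.
    pose proof (incr g Jg (fun t Ht => Rle_trans _ _ _ (proj1 (Hfg t Ht)) (proj2 (Hfg t Ht)))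
      x (Rmax x (M + 1)) (conj Hx (Rmax_l _ _))). lra.
- exists l. apply (is_RInt_gen_primitive f (fun x => RInt f 0 x)); [|exact Hl].
  intros x; apply: RInt_correct; apply If.
Qed.

Lemma exp_opp_le_1 (x : R) : 0 <= x -> exp (- x) <= 1.
Proof.
intros Hx. rewrite <- exp_0.
destruct Hx as [Hx|<-]; [apply Rlt_le, exp_increasing; lra|].
rewrite Ropp_0; lra.
Qed.

(** Half of the exponential is spent on one factor [x], since [x * exp (- (s / 2 * x)) <= 2 / s] by
    [1 + y <= exp y]; the other half is left to the induction, hence the quantifier over [s] inside
    it. *)
Lemma pow_mult_exp_bounded (k : nat) : forall s, 0 < s ->
  exists C, forall x, 0 <= x -> x ^ k * exp (- (s * x)) <= C.
Proof.
induction k as [|k IH]; intros s Hs.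
- exists 1. intros x Hx.
  rewrite /= Rmult_1_l. apply exp_opp_le_1, Rmult_le_pos; lra.
- destruct (IH (s / 2)) as [C HC]; [lra|].
  exists (2 / s * C). intros x Hx.
  replace (x ^ S k * exp (- (s * x))) with
    ((x * exp (- (s / 2 * x))) * (x ^ k * exp (- (s / 2 * x)))).
  + apply Rmult_le_compat.
    * apply Rmult_le_pos; [lra|apply Rlt_le, exp_pos].
    * apply Rmult_le_pos; [now apply pow_le|apply Rlt_le, exp_pos].
    * rewrite exp_Ropp.
      pose proof (exp_ineq1_le (s / 2 * x)).
      assert (0 <= s / 2 * x) by (apply Rmult_le_pos; lra).
      apply Rmult_le_reg_r with (exp (s / 2 * x)); [apply exp_pos|].
      rewrite -> Rmult_assoc, Rinv_l, Rmult_1_r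
        by (pose proof (exp_pos (s / 2 * x)); lra).
      apply Rmult_le_reg_l with (s / 2); [lra|].
      replace (s / 2 * (2 / s * exp (s / 2 * x))) with (exp (s / 2 * x))
        by (field; lra).
      lra.
    * now apply HC.
  + replace (- (s * x)) with (- (s / 2 * x) + - (s / 2 * x)) by lra.
    rewrite exp_plus; simpl; ring.
Qed.

(** * The exponential integral in the definition of [BesselJ] *)

Lemma sinh_ge0 (t : R) : 0 <= t -> 0 <= sinh t.
Proof.
intros Ht. unfold sinh.
assert (exp (- t) <= exp t); [|lra].
destruct Ht as [Ht|<-]; [apply Rlt_le, exp_increasing; lra|].
rewrite Ropp_0; lra.
Qed.

(* [(-1)^k] times the [k]-th derivative in [s] of the integrand of the second
   integral defining [BesselJ]. *)
Definition schlafli_kernel (alpha : R) (k : nat) (s t : R) : R :=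
  sinh t ^ k * exp (- s * sinh t - alpha * t).

Definition schlafli_moment (alpha : R) (k : nat) (s : R) : R :=
  RInt_gen (schlafli_kernel alpha k s) (at_point 0) (Rbar_locally p_infty).

Lemma schlafli_kernel_continuous (alpha : R) (k : nat) (s t : R) :
  continuous (schlafli_kernel alpha k s) t.
Proof.
apply: (ex_derive_continuous (schlafli_kernel alpha k s)).
unfold schlafli_kernel, sinh. auto_derive; exact I.
Qed.

(** The factor [exp (- (s0 * sinh t))] absorbs the power of [sinh t], the remaining
    [exp (- ((s - s0) * sinh t))] is at most 1, and [exp (- (alpha * t))] is left as majorant.
    Uniformity in [s >= s0] is what differentiation in [s] requires. *)
Lemma schlafli_kernel_dominated (alpha : R) (k : nat) (s0 : R) : 0 < s0 ->
  exists C, forall s t, s0 <= s -> 0 <= t ->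
    0 <= schlafli_kernel alpha k s t <= C * exp (- (alpha * t)).
Proof.
intros Hs0. destruct (pow_mult_exp_bounded k s0 Hs0) as [C HC].
exists C. intros s t Hs Ht. pose proof (sinh_ge0 t Ht) as Hsh.
unfold schlafli_kernel. split.
- apply Rmult_le_pos; [now apply pow_le|apply Rlt_le, exp_pos].
- replace (- s * sinh t - alpha * t)
    with (- (s0 * sinh t) + (- ((s - s0) * sinh t) + - (alpha * t))) by ring.
  rewrite -> !exp_plus.
  assert (H1 : exp (- ((s - s0) * sinh t)) <= 1).
  { apply exp_opp_le_1, Rmult_le_pos; lra. }
  pose proof (HC _ Hsh) as H2. pose proof (exp_pos (- (alpha * t))) as H3.
  pose proof (exp_pos (- ((s - s0) * sinh t))) as H5.
  assert (H4 : 0 <= sinh t ^ k * exp (- (s0 * sinh t)))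
    by (apply Rmult_le_pos; [now apply pow_le|apply Rlt_le, exp_pos]).
  rewrite <- !Rmult_assoc. apply Rmult_le_compat_r; [lra|].
  rewrite <- (Rmult_1_r C). apply Rmult_le_compat; lra.
Qed.

Lemma is_RInt_gen_schlafli (alpha : R) (k : nat) (s : R) :
  0 < alpha -> 0 < s ->
  is_RInt_gen (schlafli_kernel alpha k s) (at_point 0) (Rbar_locally p_infty)
    (schlafli_moment alpha k s).
Proof.
intros Ha Hs. destruct (schlafli_kernel_dominated alpha k s Hs) as [C HC].
apply (RInt_gen_correct (V := R_CompleteNormedModule)).
apply (ex_RInt_gen_dominated _ (fun t => C * exp (- (alpha * t))) (C * / alpha)).
- apply schlafli_kernel_continuous.
- intros t. apply: (ex_derive_continuous (fun t => C * exp (- (alpha * t)))).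
  auto_derive; exact I.
- intros t Ht. apply HC; lra.
- apply: (is_RInt_gen_scal (fun t => exp (- (alpha * t)))).
  now apply is_RInt_gen_exp.
Qed.

Lemma filter_prod_0_infty (P : R -> R -> Prop) :
  (forall b, 0 <= b -> P 0 b) ->
  filter_prod (at_point 0) (Rbar_locally p_infty) (fun ab => P (fst ab) (snd ab)).
Proof.
intros H. apply (Filter_prod _ _ _ (fun a => a = 0) (fun b => 0 < b)).
- reflexivity.
- now exists 0.
- intros a b -> Hb. apply H. simpl in *; lra.
Qed.

Lemma is_derive_schlafli_moment (alpha : R) (k : nat) (r : R) :
  0 < alpha -> 0 < r ->
  is_derive (schlafli_moment alpha k) r (- schlafli_moment alpha (S k) r).
Proof.
intros Ha Hr.
(* Order [k + 2] is the second derivative in [s], the one to be dominated; on [|s - r| <= r / 2] the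
   parameter stays above [r / 2 > 0]. *)
destruct (schlafli_kernel_dominated alpha (S (S k)) (r / 2) ltac:(lra)) as [C HC].
pose proof (is_RInt_gen_opp _ _ (is_RInt_gen_schlafli alpha (S k) r Ha Hr)) as Iopp.
replace (- schlafli_moment alpha (S k) r) with
  (RInt_gen (fun t => - schlafli_kernel alpha (S k) r t)
     (at_point 0) (Rbar_locally p_infty))
  by exact (is_RInt_gen_unique _ _ Iopp).
apply (is_derive_RInt_gen_param (at_point 0) (Rbar_locally p_infty)
  (fun s t => schlafli_kernel alpha k s t)
  (fun s t => - schlafli_kernel alpha (S k) s t)
  (fun s t => schlafli_kernel alpha (S (S k)) s t)
  (fun t => C * exp (- (alpha * t))) r (r / 2) (C * / alpha)).
- lra.
- now apply (filter_prod_0_infty (fun a b => a <= b)).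
- apply (filter_prod_0_infty (fun a b => forall t, a <= t <= b -> _)).
  intros b Hb t Ht s Hs. apply Rabs_le_between in Hs.
  split; [|split].
  + unfold schlafli_kernel. auto_derive; [exact I|]. simpl; unfold Rminus; ring.
  + unfold schlafli_kernel. auto_derive; [exact I|]. simpl; unfold Rminus; ring.
  + rewrite Rabs_pos_eq; apply HC; lra.
- intros s Hs. apply Rabs_le_between in Hs.
  eexists; apply is_RInt_gen_schlafli; lra.
- eexists; exact Iopp.
- apply: (is_RInt_gen_scal (fun t => exp (- (alpha * t)))).
  now apply is_RInt_gen_exp.
Qed.

Lemma schlafli_moment_ode (alpha r : R) : 0 < alpha -> 0 < r ->
  r ^ 2 * schlafli_moment alpha 2 r - r * schlafli_moment alpha 1 r
  + (r ^ 2 - alpha ^ 2) * schlafli_moment alpha 0 r = r - alpha.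
Proof.
intros Ha Hr.
(* [G] is a primitive of [g]: its derivative is the exponential times [(r cosh t - alpha) (r cosh t
   + alpha) - r sinh t], and [cosh^2 = 1 + sinh^2] turns this into the polynomial in [sinh t] of
   [g]. The minus sign on moment 1 comes from the factor [(-1)^k] between moments and
   derivatives. *)
set (G := fun t => - ((r * cosh t - alpha) * exp (- r * sinh t - alpha * t))).
set (g := fun t => r ^ 2 * schlafli_kernel alpha 2 r t
  - r * schlafli_kernel alpha 1 r t
  + (r ^ 2 - alpha ^ 2) * schlafli_kernel alpha 0 r t).
assert (I1 : is_RInt_gen g (at_point 0) (Rbar_locally p_infty)
  (r ^ 2 * schlafli_moment alpha 2 r - r * schlafli_moment alpha 1 r
  + (r ^ 2 - alpha ^ 2) * schlafli_moment alpha 0 r)).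
{ pose proof (fun k => is_RInt_gen_schlafli alpha k r Ha Hr) as Ik.
  apply: (is_RInt_gen_plus (fun t => _ - _) (fun t => _ * _)).
  - apply: (is_RInt_gen_minus (fun t => _ * _) (fun t => _ * _));
      apply: is_RInt_gen_scal; apply Ik.
  - apply: is_RInt_gen_scal; apply Ik. }
assert (I2 : is_RInt_gen g (at_point 0) (Rbar_locally p_infty) (r - alpha)).
{ apply (is_RInt_gen_primitive g (fun x => G x - G 0)).
  - intros x. apply (is_RInt_derive G g).
    + intros t _. unfold G, g, schlafli_kernel.
      auto_derive; [exact I|].
      assert (E : cosh t * cosh t = 1 + sinh t * sinh t).
      { unfold cosh, sinh.
        assert (E : exp t * exp (- t) = 1)
          by (rewrite <- exp_plus, Rplus_opp_r; apply exp_0).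
        apply Rminus_diag_uniq. field_simplify. nra. }
      unfold Rminus. simpl. ring [E].
    + intros t _.
      assert (Ck := fun k => schlafli_kernel_continuous alpha k r t).
      apply: (continuous_plus (fun t => _ - _) (fun t => _ * _)).
      * apply: (continuous_minus (fun t => _ * _) (fun t => _ * _));
          apply: continuous_scal_r; apply Ck.
      * apply: continuous_scal_r; apply Ck.
  - assert (G0 : G 0 = alpha - r).
    { unfold G. rewrite sinh_0 cosh_0.
      replace (- r * 0 - alpha * 0) with 0 by ring. rewrite exp_0. ring. }
    apply (is_lim_ext (fun x => G x - (alpha - r)) _ p_infty (r - alpha));
      [intros; now rewrite G0|].
    replace (Finite (r - alpha)) with (Rbar_minus 0 (alpha - r))
      by (simpl; apply f_equal; ring).
    apply (is_lim_minus _ _ _ 0 (alpha - r)); [|apply is_lim_const|reflexivity].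
    destruct (schlafli_kernel_dominated alpha 0 r Hr) as [C0 H0].
    destruct (schlafli_kernel_dominated alpha 1 r Hr) as [C1 H1].
    (* Since [cosh x = sinh x + exp (- x)], [G] is a combination of the kernels of orders 0 and 1
       with coefficients bounded by [r + alpha] and [r], so [D * exp (- (alpha * x))] dominates
       it. *)
    set (D := r * C1 + (r + alpha) * C0).
    assert (lim : forall c, is_lim (fun x => c * exp (- (alpha * x))) p_infty 0).
    { intros c. replace (Finite 0) with (Rbar_mult c 0)
        by (simpl; apply f_equal; ring).
      apply is_lim_scal_l. now apply is_lim_exp_neg_mult. }
    apply (is_lim_le_le_loc (fun x => - D * exp (- (alpha * x)))
      (fun x => D * exp (- (alpha * x)))); [|apply lim|apply lim].
    exists 0. intros x Hx.
    specialize (H0 r x (Rle_refl r) (Rlt_le _ _ Hx)).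
    specialize (H1 r x (Rle_refl r) (Rlt_le _ _ Hx)).
    set (k0 := schlafli_kernel alpha 0 r x) in *.
    set (k1 := schlafli_kernel alpha 1 r x) in *.
    replace (G x) with (- (r * k1) - (r * exp (- x) - alpha) * k0).
    2:{ unfold G, k0, k1, schlafli_kernel, cosh, sinh. simpl. field. }
    pose proof (exp_opp_le_1 x (Rlt_le _ _ Hx)). pose proof (exp_pos (- x)).
    set (e := exp (- x)) in *. set (E := exp (- (alpha * x))) in *.
    assert (r * k1 <= r * (C1 * E)) by (apply Rmult_le_compat_l; lra).
    assert (0 <= r * k1) by (apply Rmult_le_pos; lra).
    assert (Rabs ((r * e - alpha) * k0) <= (r + alpha) * (C0 * E)).
    { rewrite Rabs_mult. apply Rmult_le_compat; try apply Rabs_pos.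
      - assert (0 <= r * e) by (apply Rmult_le_pos; lra).
        assert (r * e <= r * 1) by (apply Rmult_le_compat_l; lra).
        apply Rabs_le; lra.
      - rewrite -> Rabs_pos_eq; lra. }
    match goal with H : Rabs _ <= _ |- _ => apply Rabs_le_between in H end.
    unfold D. lra. }
assert (U := fun l => is_RInt_gen_unique (V := R_CompleteNormedModule) (Fa := at_point 0) (Fb := Rbar_locally p_infty) g l).
rewrite <- (U _ I1). exact (U _ I2).
Qed.

(** * The trigonometric integral in the definition of [BesselJ] *)

Definition bessel_integral (alpha r : R) : R :=
  RInt (fun t => cos (alpha * t - r * sin t)) 0 PI.

Definition bessel_integral' (alpha r : R) : R :=
  RInt (fun t => sin t * sin (alpha * t - r * sin t)) 0 PI.

Definition bessel_integral'' (alpha r : R) : R :=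
  RInt (fun t => - (sin t ^ 2 * cos (alpha * t - r * sin t))) 0 PI.

Lemma ex_RInt_ex_derive (f : R -> R) (a b : R) :
  (forall t, ex_derive f t) -> ex_RInt f a b.
Proof.
intros H. apply: ex_RInt_continuous. intros t _.
apply: (ex_derive_continuous f). apply H.
Qed.

(** Point filters at [a] and [b] reduce this to the general statement; on a compact interval the
    constant [M] is an integrable majorant. *)
Lemma is_derive_RInt_param_C2 (f f1 f2 : R -> R -> R) (a b M : R) :
  a <= b ->
  (forall s t, is_derive (fun s => f s t) s (f1 s t)) ->
  (forall s t, is_derive (fun s => f1 s t) s (f2 s t)) ->
  (forall s t, Rabs (f2 s t) <= M) ->
  (forall s, ex_RInt (f s) a b) -> (forall s, ex_RInt (f1 s) a b) ->
  forall r, is_derive (fun s => RInt (f s) a b) r (RInt (f1 r) a b).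
Proof.
intros Hab D1 D2 HM E0 E1 r.
rewrite <- (RInt_gen_at_point (V := R_CompleteNormedModule)) by apply E1.
apply (is_derive_ext (fun s => RInt_gen (f s) (at_point a) (at_point b)));
  [intros s; now apply (RInt_gen_at_point (V := R_CompleteNormedModule))|].
assert (Hp : forall P : R -> R -> Prop, P a b ->
  filter_prod (at_point a) (at_point b) (fun ab => P (fst ab) (snd ab))).
{ intros P HP. apply (Filter_prod _ _ _ (fun x => x = a) (fun x => x = b));
    try reflexivity. now intros x y -> ->. }
apply (is_derive_RInt_gen_param (at_point a) (at_point b) f f1 f2
  (fun _ => M) r 1 (scal (b - a) M)).
- lra.
- now apply (Hp Rle).
- apply (Hp (fun a b => forall t, a <= t <= b -> _)). auto.
- intros s _. now apply (ex_RInt_gen_at_point (V := R_CompleteNormedModule)).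
- now apply (ex_RInt_gen_at_point (V := R_CompleteNormedModule)).
- apply is_RInt_gen_at_point, (is_RInt_const (V := R_NormedModule)).
Qed.

Lemma is_derive_bessel_integral (alpha r : R) :
  is_derive (bessel_integral alpha) r (bessel_integral' alpha r).
Proof.
apply (is_derive_RInt_param_C2 (fun s t => cos (alpha * t - s * sin t))
  (fun s t => sin t * sin (alpha * t - s * sin t))
  (fun s t => - (sin t ^ 2 * cos (alpha * t - s * sin t))) 0 PI 1).
- apply Rlt_le, PI_RGT_0.
- intros s t. auto_derive; [exact I|]. unfold Rminus; ring.
- intros s t. auto_derive; [exact I|]. unfold Rminus; ring.
- intros s t. rewrite -> Rabs_Ropp, Rabs_mult, <- RPow_abs.
  rewrite <- (Rmult_1_r 1). apply Rmult_le_compat; try apply Rabs_pos.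
  + apply pow_le, Rabs_pos.
  + rewrite <- (pow1 2). apply pow_incr. split; [apply Rabs_pos|].
    apply Rabs_le, SIN_bound.
  + apply Rabs_le, COS_bound.
- intros s. apply ex_RInt_ex_derive. intros t; auto_derive; exact I.
- intros s. apply ex_RInt_ex_derive. intros t; auto_derive; exact I.
Qed.

Lemma is_derive_bessel_integral' (alpha r : R) :
  is_derive (bessel_integral' alpha) r (bessel_integral'' alpha r).
Proof.
apply (is_derive_RInt_param_C2 (fun s t => sin t * sin (alpha * t - s * sin t))
  (fun s t => - (sin t ^ 2 * cos (alpha * t - s * sin t)))
  (fun s t => - (sin t ^ 3 * sin (alpha * t - s * sin t))) 0 PI 1).
- apply Rlt_le, PI_RGT_0.
- intros s t. auto_derive; [exact I|]. unfold Rminus; ring.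
- intros s t. auto_derive; [exact I|]. unfold Rminus; ring.
- intros s t. rewrite -> Rabs_Ropp, Rabs_mult, <- RPow_abs.
  rewrite <- (Rmult_1_r 1). apply Rmult_le_compat; try apply Rabs_pos.
  + apply pow_le, Rabs_pos.
  + rewrite <- (pow1 3). apply pow_incr. split; [apply Rabs_pos|].
    apply Rabs_le, SIN_bound.
  + apply Rabs_le, SIN_bound.
- intros s. apply ex_RInt_ex_derive. intros t; auto_derive; exact I.
- intros s. apply ex_RInt_ex_derive. intros t; auto_derive; exact I.
Qed.

Lemma bessel_integral_ode (alpha r : R) :
  r ^ 2 * bessel_integral'' alpha r + r * bessel_integral' alpha r
  + (r ^ 2 - alpha ^ 2) * bessel_integral alpha r
  = (r - alpha) * sin (alpha * PI).
Proof.
(* The trigonometric counterpart of the primitive used for the moments, now with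
   [cos^2 = 1 - sin^2]. The phase vanishes at [t = 0], so only the end [PI] contributes. *)
set (G := fun t => - (r * cos t + alpha) * sin (alpha * t - r * sin t)).
set (g := fun t => r ^ 2 * - (sin t ^ 2 * cos (alpha * t - r * sin t))
  + r * (sin t * sin (alpha * t - r * sin t))
  + (r ^ 2 - alpha ^ 2) * cos (alpha * t - r * sin t)).
assert (I1 : is_RInt g 0 PI
  (r ^ 2 * bessel_integral'' alpha r + r * bessel_integral' alpha r
   + (r ^ 2 - alpha ^ 2) * bessel_integral alpha r)).
{ apply: (is_RInt_plus (fun t => _ + _) (fun t => _ * _)).
  - apply: (is_RInt_plus (fun t => _ * _) (fun t => _ * _));
      apply: is_RInt_scal; apply: RInt_correct; apply ex_RInt_ex_derive;
      intros t; auto_derive; exact I.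
  - apply: is_RInt_scal; apply: RInt_correct; apply ex_RInt_ex_derive;
      intros t; auto_derive; exact I. }
assert (I2 : is_RInt g 0 PI (minus (G PI) (G 0))).
{ apply (is_RInt_derive G g).
  - intros t _. unfold G, g. auto_derive; [exact I|].
    assert (E : cos t * cos t = 1 - sin t * sin t)
      by (pose proof (sin2_cos2 t); unfold Rsqr in *; lra).
    unfold Rminus in *. simpl. ring [E].
  - intros t _. apply: (ex_derive_continuous g). unfold g. auto_derive; exact I. }
assert (U := fun l => is_RInt_unique (V := R_CompleteNormedModule) g 0 PI l).
rewrite <- (U _ I1), (U _ I2). unfold G, minus, plus, opp; simpl.
rewrite -> cos_PI, sin_PI, sin_0, !Rmult_0_r, !Rminus_0_r, sin_0. ring.
Qed.

(** * The equation and the bound for [BesselJ] *)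

(* [r J_alpha'(r)] *)
Definition bessel_flux (alpha r : R) : R :=
  r * (1 / PI * bessel_integral' alpha r
       + sin (alpha * PI) / PI * schlafli_moment alpha 1 r).

Lemma BesselJ_schlafli (alpha r : R) :
  BesselJ alpha r = 1 / PI * bessel_integral alpha r
    - sin (alpha * PI) / PI * schlafli_moment alpha 0 r.
Proof.
unfold BesselJ, schlafli_moment, bessel_integral.
replace (fun t => exp (- r * sinh t - alpha * t))
  with (schlafli_kernel alpha 0 r); [reflexivity|].
apply functional_extensionality. intros t. unfold schlafli_kernel; simpl; ring.
Qed.

Lemma BesselJ_sol (alpha : R) : 0 < alpha ->
  bessel_sol alpha (BesselJ alpha) (bessel_flux alpha).
Proof.
intros Ha r Hr. pose proof PI_RGT_0 as Hpi.
pose proof (is_derive_bessel_integral alpha r) as DA.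
pose proof (is_derive_bessel_integral' alpha r) as DA'.
pose proof (is_derive_schlafli_moment alpha 0 r Ha Hr) as DB.
pose proof (is_derive_schlafli_moment alpha 1 r Ha Hr) as DB'.
assert (EA := bessel_integral_ode alpha r).
assert (EB := schlafli_moment_ode alpha r Ha Hr).
split.
- apply (is_derive_ext (fun r => 1 / PI * bessel_integral alpha r
    - sin (alpha * PI) / PI * schlafli_moment alpha 0 r)).
  { intros s. now rewrite BesselJ_schlafli. }
  unfold bessel_flux.
  auto_derive; [repeat split; eexists; eassumption|].
  rewrite -> (is_derive_unique (fun x : R => bessel_integral alpha x) _ _ DA), (is_derive_unique (fun x : R => schlafli_moment alpha 0 x) _ _ DB).
  field; lra.
- unfold bessel_flux. auto_derive; [repeat split; eexists; eassumption|].
  rewrite -> (is_derive_unique (fun x : R => bessel_integral' alpha x) _ _ DA'), (is_derive_unique (fun x : R => schlafli_moment alpha 1 x) _ _ DB').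
  rewrite BesselJ_schlafli.
  set (A := bessel_integral alpha r) in *. set (A' := bessel_integral' alpha r) in *.
  set (A'' := bessel_integral'' alpha r) in *.
  set (B := schlafli_moment alpha 0 r) in *.
  set (B' := schlafli_moment alpha 1 r) in *. set (B'' := schlafli_moment alpha 2 r) in *.
  set (sn := sin (alpha * PI)) in *.
  (* Clearing denominators exposes the left-hand side of [EA] minus [sn] times that of [EB]. *)
  apply Rmult_eq_reg_r with (r * PI); [|apply Rmult_integral_contrapositive_currified; lra].
  apply Rminus_diag_uniq.
  transitivity ((r ^ 2 * A'' + r * A' + (r ^ 2 - alpha ^ 2) * A)
    - sn * (r ^ 2 * B'' - r * B' + (r ^ 2 - alpha ^ 2) * B)); [field; lra|].
  rewrite EA EB. ring.
Qed.

(** The cosine integral is at most [PI]; in the other one [exp (- (r * sinh t)) <= 1] leaves the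
    integral [/ alpha] of [exp (- (alpha * t))], finite because [alpha > 0]. *)
Lemma BesselJ_bounded (alpha r : R) : 0 < alpha -> 0 < r ->
  Rabs (BesselJ alpha r) <= 1 + 1 / (PI * alpha).
Proof.
intros Ha Hr. pose proof PI_RGT_0 as Hpi. rewrite BesselJ_schlafli.
assert (HA : Rabs (bessel_integral alpha r) <= (PI - 0) * 1).
{ apply abs_RInt_le_const; [lra| |].
  - apply ex_RInt_ex_derive. intros t; auto_derive; exact I.
  - intros t _. apply Rabs_le, COS_bound. }
assert (HB : Rabs (schlafli_moment alpha 0 r) <= / alpha).
{ apply (RInt_gen_norm (V := R_CompleteNormedModule)
    (schlafli_kernel alpha 0 r) (fun t => exp (- (alpha * t)))
    (Fa := at_point 0) (Fb := Rbar_locally p_infty)).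
  - now apply (filter_prod_0_infty (fun a b => a <= b)).
  - apply (filter_prod_0_infty (fun a b => forall t, a <= t <= b -> _)).
    intros b Hb t Ht. unfold norm, schlafli_kernel; simpl. unfold abs; simpl.
    rewrite -> Rmult_1_l, Rabs_pos_eq by apply Rlt_le, exp_pos.
    replace (- r * sinh t - alpha * t) with (- (r * sinh t) + - (alpha * t)) by ring.
    rewrite -> exp_plus, <- Rmult_1_l.
    apply Rmult_le_compat_r; [apply Rlt_le, exp_pos|].
    apply exp_opp_le_1, Rmult_le_pos; [lra|apply sinh_ge0; lra].
  - now apply is_RInt_gen_schlafli.
  - now apply is_RInt_gen_exp. }
assert (Hs : Rabs (sin (alpha * PI)) <= 1) by apply Rabs_le, SIN_bound.
eapply Rle_trans; [apply Rabs_triang|].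
rewrite -> Rabs_Ropp, !Rabs_mult, !Rabs_div by lra.
rewrite -> !(Rabs_pos_eq PI), Rabs_R1 by lra.
apply Rplus_le_compat.
- apply Rmult_le_reg_l with PI; [lra|].
  replace (PI * (1 / PI * Rabs (bessel_integral alpha r)))
    with (Rabs (bessel_integral alpha r)) by (field; lra). lra.
- replace (1 / (PI * alpha)) with (1 / PI * / alpha) by (field; lra).
  apply Rmult_le_compat; try apply Rabs_pos; [| |exact HB].
  + apply Rdiv_le_0_compat; [apply Rabs_pos|lra].
  + apply Rmult_le_compat_r; [|exact Hs]. apply Rlt_le, Rinv_0_lt_compat; lra.
Qed.

(** * Continuity and integration of complex-valued functions *)

Lemma continuous_C_iff (f : R -> C) (x : R) :
  continuous f x <->
  continuous (fun t => Re (f t)) x /\ continuous (fun t => Im (f t)) x.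
Proof.
split.
- intros H; split.
  + apply: (continuous_comp f fst); [exact H|apply: continuous_fst].
  + apply: (continuous_comp f snd); [exact H|apply: continuous_snd].
- intros [H1 H2].
  apply (continuous_ext (fun t => (Re (f t), Im (f t)))).
  { intros t; now destruct (f t). }
  intros P HP. apply: (filterlim_pair _ _ H1 H2 P).
  destruct HP as [eps HP].
  apply (Filter_prod _ _ _ (fun u => ball (Re (f x)) eps u)
                           (fun v => ball (Im (f x)) eps v)).
  + apply locally_ball.
  + apply locally_ball.
  + intros u v Hu Hv. apply HP. now split.
Qed.

Lemma continuous_Cmult (f g : R -> C) (x : R) :
  continuous f x -> continuous g x -> continuous (fun t => (f t * g t)%C) x.
Proof.
rewrite -> !continuous_C_iff. intros [F1 F2] [G1 G2]; split; simpl.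
- apply: (continuous_minus (fun t => _ * _) (fun t => _ * _));
    now apply: (continuous_mult (K := R_AbsRing)).
- apply: (continuous_plus (fun t => _ * _) (fun t => _ * _));
    now apply: (continuous_mult (K := R_AbsRing)).
Qed.

Lemma continuous_RtoC (f : R -> R) (x : R) :
  continuous f x -> continuous (fun t => RtoC (f t)) x.
Proof.
intros H. apply continuous_C_iff; split; [exact H|apply continuous_const].
Qed.

(** Once the limits of integration have left [[a, b]] on both sides, the integral no longer changes,
    so the double limit is attained. The value is given as a pair of real integrals to let later
    arguments work componentwise. *)
Lemma is_RInt_Rplus_compact (g : R -> C) (a b : R) :
  0 < a -> a <= b ->
  (forall x, 0 < x -> continuous g x) ->
  (forall x, 0 < x -> x < a \/ b < x -> g x = 0%C) ->
  is_RInt_gen (V := C_R_NormedModule) g (at_right 0) (Rbar_locally p_infty)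
    (RInt (fun t => Re (g t)) a b, RInt (fun t => Im (g t)) a b).
Proof.
intros Ha Hab Cg Zg P HP.
apply (Filter_prod _ _ _ (fun x => 0 < x < a) (fun y => b < y)).
- exists (mkposreal a Ha). intros y Hy H0. apply Rabs_lt_between' in Hy.
  simpl in Hy; lra.
- now exists b.
- intros x y Hx Hy. eexists; split; [|apply locally_singleton; exact HP].
  simpl.
  assert (Z : forall c d, c <= d -> (forall t, c < t < d -> g t = 0%C) ->
    is_RInt (V := C_R_NormedModule) g c d zero).
  { intros c d Hcd H0.
    apply (is_RInt_ext (fun _ => zero)).
    - intros t Ht. rewrite -> Rmin_left, Rmax_right in Ht by lra.
      symmetry; now apply H0.
    - pose proof (is_RInt_const (V := C_R_NormedModule) c d zero) as I0.
      rewrite scal_zero_r in I0. exact I0. }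
  set (l := (_, _)).
  replace l with (plus (plus (zero : C_R_NormedModule) (l : C_R_NormedModule)) zero)
    by (rewrite -> plus_zero_r, plus_zero_l; reflexivity).
  apply: (is_RInt_Chasles g x b y).
  apply: (is_RInt_Chasles g x a b).
  + apply Z; [lra|]. intros t Ht; apply Zg; lra.
  + assert (Cc : forall t, Rmin a b <= t <= Rmax a b -> continuous g t).
    { intros t Ht. rewrite -> Rmin_left, Rmax_right in Ht by lra. apply Cg; lra. }
    apply: is_RInt_fct_extend_pair; apply: RInt_correct; apply: ex_RInt_continuous;
      intros t Ht; now apply (continuous_C_iff g t), Cc.
  + apply Z; [lra|]. intros t Ht; apply Zg; lra.
Qed.

(** * Bumps and the fundamental lemma of the calculus of variations *)

(** An exponent of at least 2 smooths the kink at 0: there the increment is at most [h ^ 2] for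
    [|h| <= 1], a quadratic error with derivative 0. *)
Lemma is_derive_Rmax_pow (n : nat) (z : R) :
  is_derive (fun z => Rmax 0 z ^ S (S n)) z (INR (S (S n)) * Rmax 0 z ^ S n).
Proof.
destruct (Rtotal_order z 0) as [Hz|[->|Hz]].
- rewrite -> Rmax_left by lra. rewrite -> pow_i, Rmult_0_r by lia.
  apply (is_derive_ext_loc (fun _ => 0)); [|apply: is_derive_const].
  exists (mkposreal (- z) ltac:(lra)). intros t Ht.
  apply Rabs_lt_between' in Ht; simpl in Ht.
  rewrite -> Rmax_left by lra. rewrite -> pow_i by lia. reflexivity.
- rewrite -> Rmax_left by lra. rewrite -> pow_i, Rmult_0_r by lia.
  apply (is_derive_quadratic_error _ 0 0 1 1); [lra|]. intros h Hh.
  rewrite -> Rplus_0_l, (Rmax_left 0 0), (pow_i (S (S n))), Rmult_0_r, !Rminus_0_r, Rmult_1_r by (lra || lia).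
  destruct (Rle_or_lt h 0) as [H|H].
  + rewrite -> Rmax_left by lra. rewrite -> pow_i, Rabs_R0 by lia. apply pow2_ge_0.
  + rewrite -> Rmax_right by lra.
    rewrite -> Rabs_pos_eq by (apply pow_le; lra).
    rewrite -> Rabs_pos_eq in Hh by lra.
    replace (h ^ S (S n)) with (h ^ 2 * h ^ n) by (simpl; ring).
    rewrite <- (Rmult_1_r (h ^ 2)) at 2.
    apply Rmult_le_compat_l; [apply pow2_ge_0|].
    rewrite <- (pow1 n). apply pow_incr; lra.
- rewrite -> Rmax_right by lra.
  apply (is_derive_ext_loc (fun t => t ^ S (S n))).
  + exists (mkposreal z Hz). intros t Ht.
    apply Rabs_lt_between' in Ht; simpl in Ht.
    rewrite -> Rmax_right by lra. reflexivity.
  + auto_derive; [exact I|]. simpl; ring.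
Qed.

Definition bump_arg (x0 d x : R) : R := d ^ 2 - (x - x0) ^ 2.

(** The cube is the least integer power of a positive part that is C^2, and its derivatives remain
    explicit. *)
Definition bump (x0 d x : R) : R := Rmax 0 (bump_arg x0 d x) ^ 3.

Definition bump' (x0 d x : R) : R :=
  3 * Rmax 0 (bump_arg x0 d x) ^ 2 * (- 2 * (x - x0)).

Definition bump'' (x0 d x : R) : R :=
  6 * Rmax 0 (bump_arg x0 d x) * (- 2 * (x - x0)) ^ 2
  - 6 * Rmax 0 (bump_arg x0 d x) ^ 2.

Lemma is_derive_bump_arg (x0 d x : R) :
  is_derive (bump_arg x0 d) x (- 2 * (x - x0)).
Proof. unfold bump_arg. auto_derive; [exact I|]. simpl; ring. Qed.

Lemma is_derive_bump_pow (n : nat) (x0 d x : R) :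
  is_derive (fun x => Rmax 0 (bump_arg x0 d x) ^ S (S n)) x
    (- 2 * (x - x0) * (INR (S (S n)) * Rmax 0 (bump_arg x0 d x) ^ S n)).
Proof.
apply: (is_derive_comp (fun z => Rmax 0 z ^ S (S n)) (bump_arg x0 d)).
- apply is_derive_Rmax_pow.
- apply is_derive_bump_arg.
Qed.

Lemma is_derive_bump (x0 d x : R) : is_derive (bump x0 d) x (bump' x0 d x).
Proof.
replace (bump' x0 d x) with
  (- 2 * (x - x0) * (INR 3 * Rmax 0 (bump_arg x0 d x) ^ 2))
  by (unfold bump'; simpl; ring).
apply is_derive_bump_pow.
Qed.

Lemma is_derive_bump' (x0 d x : R) : is_derive (bump' x0 d) x (bump'' x0 d x).
Proof.
assert (L : forall (P : R -> R) l, is_derive P x l ->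
  is_derive (fun x => 3 * P x * (- 2 * (x - x0))) x
    (3 * l * (- 2 * (x - x0)) - 6 * P x)).
{ intros P l D. auto_derive; [eexists; exact D|].
  rewrite (is_derive_unique (fun x : R => P x) _ _ D). ring. }
replace (bump'' x0 d x) with
  (3 * (- 2 * (x - x0) * (INR 2 * Rmax 0 (bump_arg x0 d x) ^ 1)) * (- 2 * (x - x0))
   - 6 * Rmax 0 (bump_arg x0 d x) ^ 2) by (unfold bump''; simpl; ring).
apply (L (fun x => Rmax 0 (bump_arg x0 d x) ^ 2)), is_derive_bump_pow.
Qed.

Lemma continuous_bump'' (x0 d x : R) : continuous (bump'' x0 d) x.
Proof.
assert (C1 : continuous (fun x => Rmax 0 (bump_arg x0 d x)) x).
{ apply (continuous_ext (fun x => (bump_arg x0 d x + Rabs (bump_arg x0 d x)) / 2)).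
  - intros t. unfold Rmax, Rabs. destruct (Rle_dec _ _), (Rcase_abs _); lra.
  - assert (C0 : continuous (bump_arg x0 d) x)
      by (apply: ex_derive_continuous; eexists; apply is_derive_bump_arg).
    apply: (continuous_mult (K := R_AbsRing)); [|apply: continuous_const].
    apply: continuous_plus; [exact C0|].
    apply: (continuous_comp (bump_arg x0 d) Rabs); [exact C0|apply: continuous_Rabs]. }
apply: (continuous_minus (fun t => _ * _) (fun t => _ * _)).
- apply: (continuous_mult (K := R_AbsRing)).
  + apply: (continuous_mult (K := R_AbsRing)); [apply: continuous_const|exact C1].
  + apply: (ex_derive_continuous (fun t => (-2 * (t - x0)) ^ 2)). auto_derive; exact I.
- apply: (continuous_mult (K := R_AbsRing)); [apply: continuous_const|].
  apply: (ex_derive_continuous (fun t => Rmax 0 (bump_arg x0 d t) ^ 2)).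
  eexists; apply is_derive_bump_pow.
Qed.

Lemma bump_outside (x0 d x : R) : 0 < d -> x <= x0 - d \/ x0 + d <= x ->
  bump x0 d x = 0 /\ bump' x0 d x = 0 /\ bump'' x0 d x = 0.
Proof.
intros Hd Hx.
assert (Rmax 0 (bump_arg x0 d x) = 0) as E.
{ apply Rmax_left. unfold bump_arg.
  replace (d ^ 2 - (x - x0) ^ 2) with ((d - (x - x0)) * (d + (x - x0))) by ring.
  destruct Hx; nra. }
unfold bump, bump', bump''. rewrite E. repeat split; ring.
Qed.

Lemma bump_gt0 (x0 d x : R) : x0 - d < x < x0 + d -> 0 < bump x0 d x.
Proof.
intros Hx. unfold bump, bump_arg. apply pow_lt.
eapply Rlt_le_trans; [|apply Rmax_r]. nra.
Qed.

(** At a point where [q] is positive, continuity keeps it positive on a small interval, and the bump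
    carried by that interval has a positive integral against [q]; a negative value is handled
    through [- q]. *)
Lemma weak_zero (q : R -> R) :
  (forall x, 0 < x -> continuous q x) ->
  (forall x0 d, 0 < d -> d < x0 ->
     RInt (fun x => q x * bump x0 d x) (x0 - d) (x0 + d) = 0) ->
  forall x, 0 < x -> q x = 0.
Proof.
intros Cq W x Hx.
assert (Cb : forall x0 d t, continuous (bump x0 d) t).
{ intros x0 d t. apply: ex_derive_continuous; eexists; apply is_derive_bump. }
assert (main : forall p : R -> R, (forall x, 0 < x -> continuous p x) ->
  0 < p x -> exists d, 0 < d /\ d < x /\
     0 < RInt (fun t => p t * bump x d t) (x - d) (x + d)).
{ intros p Cp Hp.
  destruct (Cp x Hx (fun y => 0 < y)) as [eps Heps]; [now apply: open_gt|].
  (* [eps / 2] keeps the interval where [p] is positive, [x / 2] keeps it inside R_+. *)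
  set (d := Rmin (eps / 2) (x / 2)).
  assert (Hd : 0 < d) by (apply Rmin_pos; [apply is_pos_div_2|lra]).
  assert (d <= eps / 2) by apply Rmin_l. assert (d <= x / 2) by apply Rmin_r.
  pose proof (cond_pos eps).
  exists d; split; [exact Hd|]; split; [lra|].
  apply RInt_gt_0; [lra| |].
  - intros t Ht. apply Rmult_lt_0_compat; [|now apply bump_gt0].
    apply Heps. apply Rabs_lt_between'. lra.
  - intros t Ht. apply: (continuous_mult (K := R_AbsRing)); [apply Cp; lra|apply Cb]. }
destruct (Rtotal_order (q x) 0) as [H|[H|H]]; [exfalso|exact H|exfalso].
- destruct (main (fun t => - q t)) as [d [Hd [Hdx Hi]]].
  + intros t Ht. now apply: continuous_opp; apply Cq.
  + lra.
  + assert (Eq : RInt (fun t => - q t * bump x d t) (x - d) (x + d)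
      = opp (RInt (fun t => q t * bump x d t) (x - d) (x + d))).
    { rewrite <- RInt_opp.
      - apply RInt_ext. intros t _. unfold opp; simpl; ring.
      - apply: ex_RInt_continuous. intros t Ht.
        rewrite -> Rmin_left, Rmax_right in Ht by lra.
        apply: (continuous_mult (K := R_AbsRing)); [apply Cq; lra|apply Cb]. }
    rewrite -> Eq, W in Hi by assumption. unfold opp in Hi; simpl in Hi; lra.
- destruct (main q Cq H) as [d [Hd [Hdx Hi]]]. rewrite W in Hi; lra.
Qed.

(** * Complex derivatives, and bumps as test functions *)

(** Taken with [fst], [snd] and [RtoC], it passes between derivability in [C_R_NormedModule] and
    derivability of real functions. *)
Lemma is_derive_linear_comp (U V : NormedModule R_AbsRing) (L : U -> V)
  (f : R -> U) (x : R) (l : U) :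
  is_linear L -> is_derive f x l -> is_derive (fun t => L (f t)) x (L l).
Proof.
intros HL Hf. unfold is_derive in *.
apply (filterdiff_ext_lin (fun t => L (f t)) (fun y => L (scal y l))).
- apply (filterdiff_comp f L (fun y => scal y l) L); [exact Hf|].
  now apply filterdiff_linear.
- intros y. apply (linear_scal L HL).
Qed.

Lemma ex_derive_Re (f : R -> C) (x : R) :
  @ex_derive R_AbsRing C_R_NormedModule f x -> ex_derive (fun t => Re (f t)) x.
Proof.
intros [l Hl]. exists (fst l).
apply (is_derive_linear_comp C_R_NormedModule R_NormedModule fst); [|exact Hl].
apply is_linear_fst.
Qed.

Lemma ex_derive_Im (f : R -> C) (x : R) :
  @ex_derive R_AbsRing C_R_NormedModule f x -> ex_derive (fun t => Im (f t)) x.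
Proof.
intros [l Hl]. exists (snd l).
apply (is_derive_linear_comp C_R_NormedModule R_NormedModule snd); [|exact Hl].
apply is_linear_snd.
Qed.

Lemma ex_derive_RtoC (f : R -> R) (x : R) :
  ex_derive f x -> @ex_derive R_AbsRing C_R_NormedModule (fun t => RtoC (f t)) x.
Proof.
intros [l Hl]. exists (RtoC l).
apply (is_derive_linear_comp R_NormedModule C_R_NormedModule RtoC); [|exact Hl].
apply (is_linear_prod (fun t : R => t) (fun _ => 0)).
- apply is_linear_id.
- apply (is_linear_zero (U := R_NormedModule) (V := R_NormedModule)).
Qed.

Lemma derive_RC_RtoC (f f' : R -> R) :
  (forall x, is_derive f x (f' x)) ->
  derive_RC (fun t => RtoC (f t)) = (fun x => RtoC (f' x)).
Proof.
intros H. apply functional_extensionality. intros x.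
unfold derive_RC, RtoC; simpl. apply f_equal2.
- now apply is_derive_unique.
- apply Derive_const.
Qed.

Lemma ex_derive_continuous_C (f : R -> C) (x : R) :
  @ex_derive R_AbsRing C_R_NormedModule f x -> continuous f x.
Proof.
intros H. apply continuous_C_iff. split.
- apply: ex_derive_continuous; now apply ex_derive_Re.
- apply: ex_derive_continuous; now apply ex_derive_Im.
Qed.

Lemma Cc2_Cc (f : R -> C) : Cc2 f -> Cc f.
Proof.
intros [[D _] S]; split; [|exact S].
intros x Hx. now apply ex_derive_continuous_C, D.
Qed.

Lemma Cc2_bump (x0 d : R) : 0 < d -> d < x0 -> Cc2 (fun x => RtoC (bump x0 d x)).
Proof.
intros Hd Hx0. split; [split; [|split]|].
- intros x _. apply ex_derive_RtoC. eexists; apply is_derive_bump.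
- intros x _. rewrite (derive_RC_RtoC _ _ (is_derive_bump x0 d)).
  apply ex_derive_RtoC. eexists; apply is_derive_bump'.
- intros x _. rewrite (derive_RC_RtoC _ _ (is_derive_bump x0 d)).
  rewrite (derive_RC_RtoC _ _ (is_derive_bump' x0 d)).
  apply continuous_RtoC, continuous_bump''.
- exists (x0 - d), (x0 + d). split; [lra|]. intros x _ Hx.
  destruct (bump_outside x0 d x Hd) as [-> _]; [lra|reflexivity].
Qed.

Definition bessel_bump (alpha x0 d x : R) : R :=
  bump'' x0 d x + 1 / x * bump' x0 d x - alpha ^ 2 / x ^ 2 * bump x0 d x.

Lemma Bessel_op_bump (alpha x0 d : R) :
  Bessel_op alpha (fun x => RtoC (bump x0 d x))
  = (fun x => RtoC (bessel_bump alpha x0 d x)).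
Proof.
apply functional_extensionality. intros x. unfold Bessel_op.
rewrite (derive_RC_RtoC _ _ (is_derive_bump x0 d)).
rewrite (derive_RC_RtoC _ _ (is_derive_bump' x0 d)).
unfold bessel_bump. now rewrite -> RtoC_minus, RtoC_plus, !RtoC_mult.
Qed.

Lemma continuous_bump (x0 d x : R) : continuous (bump x0 d) x.
Proof. apply: ex_derive_continuous; eexists; apply is_derive_bump. Qed.

Lemma continuous_bump' (x0 d x : R) : continuous (bump' x0 d) x.
Proof. apply: ex_derive_continuous; eexists; apply is_derive_bump'. Qed.

Lemma continuous_bessel_bump (alpha x0 d x : R) :
  0 < x -> continuous (bessel_bump alpha x0 d) x.
Proof.
intros Hx.
apply: (continuous_minus (fun t => _ + _) (fun t => _ * _)).
- apply: (continuous_plus (bump'' x0 d) (fun t => _ * _)); [apply continuous_bump''|].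
  apply: (continuous_mult (K := R_AbsRing)); [|apply continuous_bump'].
  apply: (ex_derive_continuous (fun t => 1 / t)). auto_derive; lra.
- apply: (continuous_mult (K := R_AbsRing)); [|apply continuous_bump].
  apply: (ex_derive_continuous (fun t => alpha ^ 2 / t ^ 2)). auto_derive.
  apply Rmult_integral_contrapositive_currified; lra.
Qed.

(** The integral formula for [T] is available on [Cc] only, so this membership is what turns the
    left-hand side of (i) into an integral. *)
Lemma Cc_bessel_bump (alpha x0 d : R) : 0 < d -> d < x0 ->
  Cc (fun x => RtoC (bessel_bump alpha x0 d x)).
Proof.
intros Hd Hx0; split.
- intros x Hx. now apply continuous_RtoC, continuous_bessel_bump.
- exists (x0 - d), (x0 + d). split; [lra|]. intros x _ Hx. unfold bessel_bump.
  destruct (bump_outside x0 d x Hd) as [-> [-> ->]]; [lra|].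
  apply f_equal; ring.
Qed.

(** * Evaluation of the integral transforms *)

Lemma continuous_transform_integrand (K f : R -> C) (y x : R) :
  continuous_Rplus K -> continuous_Rplus f -> 0 < y -> 0 < x ->
  continuous (fun x => (K (y * x)%R * f x * RtoC x)%C) x.
Proof.
intros CK Cf Hy Hx. apply continuous_Cmult; [apply continuous_Cmult|].
- apply: (continuous_comp (fun x => y * x) K).
  + apply: (ex_derive_continuous (fun x => y * x)). auto_derive; exact I.
  + apply CK. now apply Rmult_lt_0_compat.
- now apply Cf.
- apply continuous_RtoC, continuous_id.
Qed.

Lemma integral_transform_correct (K f : R -> C) (a b y : R) :
  0 < a -> a <= b -> 0 < y ->
  continuous_Rplus K -> continuous_Rplus f ->
  (forall x, 0 < x -> x < a \/ b < x -> f x = 0%C) ->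
  is_RInt_gen (V := C_R_NormedModule) (fun x => (K (y * x)%R * f x * RtoC x)%C)
    (at_right 0) (Rbar_locally p_infty)
    (RInt (fun x => Re (K (y * x)%R * f x * RtoC x)%C) a b,
     RInt (fun x => Im (K (y * x)%R * f x * RtoC x)%C) a b).
Proof.
intros Ha Hab Hy CK Cf Zf. apply is_RInt_Rplus_compact; try assumption.
- intros x Hx. now apply continuous_transform_integrand.
- intros x Hx Hx'. rewrite -> Zf by assumption. ring.
Qed.

Lemma integral_transform_scal (K J f : R -> C) (c : C) (y : R) :
  0 < y -> continuous_Rplus J -> Cc f ->
  (forall x, 0 < x -> K x = (c * J x)%C) ->
  integral_transform K f y = (c * integral_transform J f y)%C.
Proof.
intros Hy CJ [Cf [a [b [Ha Zf]]]] HK.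
assert (CK : continuous_Rplus K).
{ intros x Hx. apply (continuous_ext_loc _ (fun x => c * J x)%C).
  - exists (mkposreal x Hx). intros t Ht. apply Rabs_lt_between' in Ht; simpl in Ht.
    symmetry; apply HK; lra.
  - apply continuous_Cmult; [apply continuous_const|now apply CJ]. }
(* The definition of compact support does not order [a] and [b]; enlarging [b] does. *)
set (b' := Rmax a b).
assert (Hb : a <= b') by apply Rmax_l.
assert (Zf' : forall x, 0 < x -> x < a \/ b' < x -> f x = 0%C).
{ intros x Hx Hx'. apply Zf; [exact Hx|]. pose proof (Rmax_r a b). unfold b' in Hx'; lra. }
unfold integral_transform, integral_Rplus.
rewrite (is_RInt_gen_unique (V := C_R_CompleteNormedModule) _ _
  (integral_transform_correct K f a b' y Ha Hb Hy CK Cf Zf')).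
rewrite (is_RInt_gen_unique (V := C_R_CompleteNormedModule) _ _
  (integral_transform_correct J f a b' y Ha Hb Hy CJ Cf Zf')).
set (h := fun x => (J (y * x)%R * f x * RtoC x)%C).
assert (Eh : ex_RInt (fun x => Re (h x)) a b' /\ ex_RInt (fun x => Im (h x)) a b').
{ split; apply: ex_RInt_continuous; intros x Hx;
    rewrite -> Rmin_left, Rmax_right in Hx by lra;
    apply (continuous_C_iff h x), continuous_transform_integrand;
    solve [assumption | lra]. }
destruct Eh as [E1 E2].
pose proof (RInt_correct (V := R_CompleteNormedModule) _ _ _ E1) as I1.
pose proof (RInt_correct (V := R_CompleteNormedModule) _ _ _ E2) as I2.
assert (EK : forall x, Rmin a b' < x < Rmax a b' ->
  (K (y * x)%R * f x * RtoC x = c * h x)%C).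
{ intros x Hx. rewrite -> Rmin_left, Rmax_right in Hx by lra.
  rewrite -> HK by (apply Rmult_lt_0_compat; lra). unfold h; ring. }
apply (f_equal2 (@pair R R)); apply (is_RInt_unique (V := R_CompleteNormedModule)).
- apply (is_RInt_ext (fun x => fst c * Re (h x) - snd c * Im (h x))).
  + intros x Hx. now rewrite EK.
  + apply: (is_RInt_minus (fun t => _ * _) (fun t => _ * _)); now apply: is_RInt_scal.
- apply (is_RInt_ext (fun x => fst c * Im (h x) + snd c * Re (h x))).
  + intros x Hx. now rewrite EK.
  + apply: (is_RInt_plus (fun t => _ * _) (fun t => _ * _)); now apply: is_RInt_scal.
Qed.

(** Against a real test function the real and imaginary parts of [K] decouple. *)
Lemma integral_transform_real (K : R -> C) (psi : R -> R) (a b : R) :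
  0 < a -> a <= b ->
  continuous_Rplus K -> (forall x, 0 < x -> continuous psi x) ->
  (forall x, 0 < x -> x < a \/ b < x -> psi x = 0) ->
  integral_transform K (fun x => RtoC (psi x)) 1
  = (RInt (fun x => Re (K x) * psi x * x) a b,
     RInt (fun x => Im (K x) * psi x * x) a b).
Proof.
intros Ha Hab CK Cpsi Zpsi.
unfold integral_transform, integral_Rplus.
rewrite (is_RInt_gen_unique (V := C_R_CompleteNormedModule) _ _
  (integral_transform_correct K (fun x => RtoC (psi x)) a b 1 Ha Hab Rlt_0_1 CK
    (fun x Hx => continuous_RtoC _ _ (Cpsi x Hx))
    (fun x Hx H => f_equal RtoC (Zpsi x Hx H)))).
apply f_equal2; apply RInt_ext; intros x _; rewrite Rmult_1_l; unfold Re, Im; simpl; ring.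
Qed.

(** * Bessel's equation for the kernel *)

Lemma weak_bessel_sol (alpha : R) (u u1 u2 : R -> R) :
  (forall x, 0 < x -> is_derive u x (u1 x)) ->
  (forall x, 0 < x -> is_derive u1 x (u2 x)) ->
  (forall x, 0 < x -> continuous u2 x) ->
  (forall x0 d, 0 < d -> d < x0 ->
     RInt (fun x => u x * bessel_bump alpha x0 d x * x) (x0 - d) (x0 + d)
     = - RInt (fun x => u x * bump x0 d x * x) (x0 - d) (x0 + d)) ->
  bessel_sol alpha u (fun x => x * u1 x).
Proof.
intros D1 D2 C2 W.
assert (Cu : forall x, 0 < x -> continuous u x)
  by (intros x Hx; apply: ex_derive_continuous; eexists; now apply D1).
assert (Cu1 : forall x, 0 < x -> continuous u1 x)
  by (intros x Hx; apply: ex_derive_continuous; eexists; now apply D2).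
(* Integrating by parts against a bump, the boundary terms
   [w = x (u phi' - u' phi)] vanish and leave [int q phi = 0]. *)
set (q := fun x => u1 x + x * u2 x + (x - alpha ^ 2 / x) * u x).
assert (Cq : forall x, 0 < x -> continuous q x).
{ intros x Hx.
  apply: (continuous_plus (fun t => _ + _) (fun t => _ * _)).
  - apply: (continuous_plus u1 (fun t => _ * _)); [now apply Cu1|].
    apply: (continuous_mult (K := R_AbsRing)); [apply: continuous_id|now apply C2].
  - apply: (continuous_mult (K := R_AbsRing)); [|now apply Cu].
    apply: (ex_derive_continuous (fun t => t - alpha ^ 2 / t)). auto_derive; lra. }
assert (Q : forall x, 0 < x -> q x = 0).
{ apply weak_zero; [exact Cq|]. intros x0 d Hd Hx0.
  (* Lagrange's identity: with respect to [x dx] the Bessel operator is symmetric, because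
     [x (phi'' + phi' / x) = (x phi')']. Hence [w' = u (x phi')' - (x u')' phi], the terms in
     [alpha^2] and in [x u phi] cancelling against those of [q], which is the Bessel expression of
     [u] divided by [x]. *)
  set (w := fun x => x * (u x * bump' x0 d x - u1 x * bump x0 d x)).
  set (w' := fun x => u x * bessel_bump alpha x0 d x * x + u x * bump x0 d x * x
                      - q x * bump x0 d x).
  assert (pos : forall t, Rmin (x0 - d) (x0 + d) <= t <= Rmax (x0 - d) (x0 + d) -> 0 < t)
    by (intros t; rewrite -> Rmin_left, Rmax_right by lra; lra).
  assert (Cx : forall v b : R -> R, forall x, continuous v x -> continuous b x ->
     continuous (fun x => v x * b x * x) x).
  { intros v b x Cv Cb. apply: (continuous_mult (K := R_AbsRing)); [|apply: continuous_id].
    now apply: (continuous_mult (K := R_AbsRing)). }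
  assert (E1 : ex_RInt (fun x => u x * bessel_bump alpha x0 d x * x) (x0 - d) (x0 + d)).
  { apply: ex_RInt_continuous. intros t Ht%pos. apply Cx; [now apply Cu|].
    now apply continuous_bessel_bump. }
  assert (E2 : ex_RInt (fun x => u x * bump x0 d x * x) (x0 - d) (x0 + d)).
  { apply: ex_RInt_continuous. intros t Ht%pos. apply Cx; [now apply Cu|].
    apply continuous_bump. }
  assert (E3 : ex_RInt (fun x => q x * bump x0 d x) (x0 - d) (x0 + d)).
  { apply: ex_RInt_continuous. intros t Ht%pos.
    apply: (continuous_mult (K := R_AbsRing)); [now apply Cq|apply continuous_bump]. }
  assert (I1 : is_RInt w' (x0 - d) (x0 + d) (minus (w (x0 + d)) (w (x0 - d)))).
  { apply (is_RInt_derive w w').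
    - intros t Ht%pos. unfold w.
      pose proof (is_derive_bump x0 d t) as B1. pose proof (is_derive_bump' x0 d t) as B2.
      pose proof (D1 t Ht) as U1. pose proof (D2 t Ht) as U2.
      assert (L : forall p p' : R -> R, forall l l', is_derive p t l -> is_derive p' t l' ->
        is_derive (fun x => x * (u x * p' x - u1 x * p x)) t
         (u t * p' t - u1 t * p t + t * (u1 t * p' t + u t * l' - u2 t * p t - u1 t * l))).
      { intros p p' l l' P1 P2.
        auto_derive; [repeat split; eexists; eassumption|].
        rewrite -> (is_derive_unique (fun x : R => p x) _ _ P1),
          (is_derive_unique (fun x : R => p' x) _ _ P2),
          (is_derive_unique (fun x : R => u x) _ _ U1),
          (is_derive_unique (fun x : R => u1 x) _ _ U2). ring. }
      replace (w' t) with (u t * bump' x0 d t - u1 t * bump x0 d t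
        + t * (u1 t * bump' x0 d t + u t * bump'' x0 d t
               - u2 t * bump x0 d t - u1 t * bump' x0 d t)).
      + now apply L.
      + unfold w', q, bessel_bump. field; lra.
    - intros t Ht%pos.
      apply: (continuous_minus (fun t => _ + _) (fun t => _ * _)).
      + apply: (continuous_plus (fun t => _ * _) (fun t => _ * _)); apply Cx.
        * now apply Cu.
        * now apply continuous_bessel_bump.
        * now apply Cu.
        * apply continuous_bump.
      + apply: (continuous_mult (K := R_AbsRing)); [now apply Cq|apply continuous_bump]. }
  pose proof (is_RInt_minus _ _ _ _ _ _ (is_RInt_plus _ _ _ _ _ _
    (RInt_correct (V := R_CompleteNormedModule) _ _ _ E1)
    (RInt_correct (V := R_CompleteNormedModule) _ _ _ E2))
    (RInt_correct (V := R_CompleteNormedModule) _ _ _ E3)) as I2.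
  apply (is_RInt_unique (V := R_CompleteNormedModule)) in I1.
  apply (is_RInt_unique (V := R_CompleteNormedModule)) in I2.
  assert (E : minus (w (x0 + d)) (w (x0 - d)) = 0).
  { unfold w.
    destruct (bump_outside x0 d (x0 + d) Hd) as [-> [-> _]]; [lra|].
    destruct (bump_outside x0 d (x0 - d) Hd) as [-> [-> _]]; [lra|].
    unfold minus, plus, opp; simpl; ring. }
  rewrite E in I1. rewrite -> W in I2 by assumption.
  unfold w' in I1. unfold minus, plus, opp in I2; simpl in I2.
  unfold Rminus in *. lra. }
intros x Hx. split.
- replace (x * u1 x / x) with (u1 x) by (field; lra). now apply D1.
- pose proof (D2 x Hx) as U2. pose proof (Q x Hx) as Qx. unfold q in Qx.
  auto_derive; [eexists; exact U2|].
  rewrite (is_derive_unique (fun x : R => u1 x) _ _ U2).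
  lra.
Qed.

Lemma kernel_bessel_sol (alpha : R) (K : R -> C) :
  C2_Rplus K ->
  (forall x0 d, 0 < d -> d < x0 ->
     integral_transform K (fun x => RtoC (bessel_bump alpha x0 d x)) 1
     = (- integral_transform K (fun x => RtoC (bump x0 d x)) 1)%C) ->
  bessel_sol alpha (fun x => Re (K x)) (fun x => x * Derive (fun t => Re (K t)) x) /\
  bessel_sol alpha (fun x => Im (K x)) (fun x => x * Derive (fun t => Im (K t)) x).
Proof.
intros [K1 [K2 K3]] W.
assert (CK : continuous_Rplus K) by (intros x Hx; now apply ex_derive_continuous_C, K1).
assert (W2 : forall x0 d, 0 < d -> d < x0 ->
  (RInt (fun x => Re (K x) * bessel_bump alpha x0 d x * x) (x0 - d) (x0 + d),
   RInt (fun x => Im (K x) * bessel_bump alpha x0 d x * x) (x0 - d) (x0 + d))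
  = (- RInt (fun x => Re (K x) * bump x0 d x * x) (x0 - d) (x0 + d),
     - RInt (fun x => Im (K x) * bump x0 d x * x) (x0 - d) (x0 + d))).
{ intros x0 d Hd Hx0. specialize (W x0 d Hd Hx0).
  rewrite -> (integral_transform_real K (bump x0 d) (x0 - d) (x0 + d)),
    (integral_transform_real K (bessel_bump alpha x0 d) (x0 - d) (x0 + d)) in W;
    try assumption; try lra.
  - intros x Hx; now apply continuous_bessel_bump.
  - intros x _ Hx. unfold bessel_bump.
    destruct (bump_outside x0 d x Hd) as [-> [-> ->]]; [lra|ring].
  - intros x _; apply continuous_bump.
  - intros x _ Hx; apply bump_outside; lra. }
split.
- apply (weak_bessel_sol alpha _ _ (Derive (Derive (fun t => Re (K t))))).
  + intros x Hx. apply Derive_correct. now apply ex_derive_Re, K1.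
  + intros x Hx. apply Derive_correct. apply (ex_derive_Re (derive_RC K)). now apply K2.
  + intros x Hx. apply (continuous_C_iff (derive_RC (derive_RC K)) x). now apply K3.
  + intros x0 d Hd Hx0. exact (f_equal Re (W2 x0 d Hd Hx0)).
- apply (weak_bessel_sol alpha _ _ (Derive (Derive (fun t => Im (K t))))).
  + intros x Hx. apply Derive_correct. now apply ex_derive_Im, K1.
  + intros x Hx. apply Derive_correct. apply (ex_derive_Im (derive_RC K)). now apply K2.
  + intros x Hx. apply (continuous_C_iff (derive_RC (derive_RC K)) x). now apply K3.
  + intros x0 d Hd Hx0. exact (f_equal Im (W2 x0 d Hd Hx0)).
Qed.

(** * Identification of the kernel with a multiple of [BesselJ] *)

Lemma bounded_bessel_sol_proportional (alpha : R) (u v j w : R -> R) (M N : R) :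
  0 < alpha -> bessel_sol alpha u v -> bessel_sol alpha j w ->
  (forall t, 0 < t -> Rabs (u t) <= M) -> (forall t, 0 < t -> Rabs (j t) <= N) ->
  j alpha <> 0 -> forall x, 0 < x -> u x = u alpha / j alpha * j x.
Proof.
intros Ha Hu Hj HM HN Hj0 x Hx.
set (c := u alpha / j alpha).
assert (Z : 1 * u x + - c * j x = 0); [|lra].
apply (bounded_bessel_sol_vanish alpha _ _ (M + Rabs c * N) Ha
  (bessel_sol_lin alpha u v j w 1 (- c) Hu Hj)); [| |exact Hx].
- intros t Ht. eapply Rle_trans; [apply Rabs_triang|].
  rewrite -> !Rabs_mult, Rabs_R1, Rabs_Ropp.
  pose proof (HM t Ht).
  pose proof (Rmult_le_compat_l _ _ _ (Rabs_pos c) (HN t Ht)). lra.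
- unfold c. field. exact Hj0.
Qed.

Theorem theorem5
  (alpha : R) (halpha : 0 < alpha)
  (K : R -> C) (hK_C2 : C2_Rplus K) (hK_bounded : bounded_Rplus K)
  (T : (R -> C) -> (R -> C))
  (hT_C0 : forall f : R -> C, Cc f -> C0 (T f))
  (hT_formula : forall f : R -> C, Cc f ->
     forall y : R, 0 < y -> T f y = integral_transform K f y)
  (hT_Bessel : forall f : R -> C, Cc2 f ->
     forall y : R, 0 < y ->
       T (Bessel_op alpha f) y = (- RtoC (y ^ 2) * T f y)%C)
  (hT_point : exists (fstar : R -> C) (ystar : R),
     Cc2 fstar /\ 0 < ystar /\
     T fstar ystar = Hankel alpha fstar ystar /\
     Hankel alpha fstar ystar <> 0%C) :
  forall f : R -> C, Cc f ->
    forall y : R, 0 < y -> T f y = Hankel alpha f y.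
Proof.
destruct (kernel_bessel_sol alpha K hK_C2) as [SRe SIm].
{ intros x0 d Hd Hx0.
  pose proof (hT_Bessel _ (Cc2_bump x0 d Hd Hx0) 1 Rlt_0_1) as E.
  rewrite Bessel_op_bump in E.
  rewrite -> (hT_formula _ (Cc_bessel_bump alpha x0 d Hd Hx0) 1 Rlt_0_1),
    (hT_formula _ (Cc2_Cc _ (Cc2_bump x0 d Hd Hx0)) 1 Rlt_0_1), pow1 in E.
  rewrite E. ring. }
destruct hK_bounded as [M HM].
pose proof (BesselJ_sol alpha halpha) as SJ.
pose proof (fun r Hr => BesselJ_bounded alpha r halpha Hr) as BJ.
assert (CJ : continuous_Rplus (fun r => RtoC (BesselJ alpha r))).
{ intros x Hx. apply continuous_RtoC. apply: ex_derive_continuous.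
  eexists; now apply SJ. }
destruct hT_point as [fs [ys [Hfs [Hys [Heq Hne]]]]].
(* A zero at [alpha] would make [BesselJ alpha] vanish on R_+, and its transform with it; the factor
   [0] in [integral_transform_scal] evaluates that null transform. *)
assert (HJ0 : BesselJ alpha alpha <> 0).
{ intros H0. apply Hne.
  pose proof (bounded_bessel_sol_vanish alpha _ _ _ halpha SJ BJ H0) as Z.
  unfold Hankel.
  rewrite (integral_transform_scal _ (fun r => RtoC (BesselJ alpha r)) fs 0%C ys
    Hys CJ (Cc2_Cc _ Hfs)).
  - ring.
  - intros x Hx. rewrite -> Z by exact Hx. ring. }
(* [BesselJ] being real, the quotient of the two values at [alpha] is taken componentwise, and the
   real proportionality applies to each part of [K]. *)
set (c := (Re (K alpha) / BesselJ alpha alpha, Im (K alpha) / BesselJ alpha alpha) : C).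
assert (HK : forall x, 0 < x -> K x = (c * RtoC (BesselJ alpha x))%C).
{ intros x Hx.
  pose proof (bounded_bessel_sol_proportional alpha _ _ _ _ M _ halpha SRe SJ
    (fun t Ht => Rle_trans _ _ _ (Rle_trans _ _ _ (Rmax_l _ _) (Rmax_Cmod (K t))) (HM t Ht)) BJ HJ0 x Hx) as ERe.
  pose proof (bounded_bessel_sol_proportional alpha _ _ _ _ M _ halpha SIm SJ
    (fun t Ht => Rle_trans _ _ _ (Rle_trans _ _ _ (Rmax_r _ _) (Rmax_Cmod (K t))) (HM t Ht)) BJ HJ0 x Hx) as EIm.
  rewrite (surjective_pairing (K x)). unfold Cmult, c; simpl.
  apply f_equal2; [rewrite -> ERe at 1 | rewrite -> EIm at 1]; simpl; ring. }
assert (HT : forall f, Cc f -> forall y, 0 < y -> T f y = (c * Hankel alpha f y)%C).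
{ intros f Hf y Hy. rewrite -> hT_formula by assumption.
  now apply integral_transform_scal. }
assert (Hc : c = 1%C).
{ rewrite -> HT in Heq by (try apply Cc2_Cc; assumption).
  transitivity (c * Hankel alpha fs ys / Hankel alpha fs ys)%C.
  - field. exact Hne.
  - rewrite Heq. field. exact Hne. }
intros f Hf y Hy. rewrite -> HT, Hc by assumption. ring.
Qed.
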